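(* Let $s\in(0,1)$, $\gamma\in(0,1]$, $n>2s$, let $\Omega\subset\mathbb{R}^n$ be a bounded domain, and let $\mathbb{G}$ be a Green kernel on $\Omega$ with Green operator $\mathcal{G}$ and heat semigroup $\mathcal{S}(t)$ as in the context. Assume: (1) $\mathbb{G}(x,y)=\mathbb{G}(y,x)\asymp |x-y|^{-(n-2s)}\left(\frac{\delta(x)\delta(y)}{|x-y|^2}\wedge 1\right)^{\gamma}$ for all $x\neq y$ in $\Omega$; (2) $\mathcal{G}:\delta^\gamma L^\infty(\Omega)\to\delta^\gamma C(\overline\Omega)$ is continuous; (3) for all $t\ge 0$, $0\le u_0\le 1$ implies $0\le \mathcal{S}(t)[u_0]\le 1$. Then $\mathcal{S}(t)$ is ultracontractive and regularises up to the boundary, in the sense that $$\mathcal{S}(t):L^2(\Omega)\to\delta^\gamma C(\overline\Omega)\qquad\text{and}\qquad \mathcal{S}(t):M(\Omega,\delta^\gamma)\to L^2(\Omega)$$ are continuous for all $t>0$. Moreover, the heat kernel $\mathbb{S}(t,x,y)=\mathcal{S}(t)[\delta_y](x)$ exists pointwise for $(t,x,y)\in(0,\infty)\times\Omega\times\Omega$, and its $\gamma$-normal derivative $D_\gamma\mathbb{S}(t,\zeta,y)=\lim_{x\to\zeta,\,x\in\Omega}\mathbb{S}(t,x,y)/\delta(x)^\gamma$ exists pointwise for $(t,\zeta,y)\in(0,\infty)\times\partial\Omega\times\Omega$. Furthermore, for every $t>0$ there is a constant $C(t)>0$ such that for all $x,y\in\Omega$ and $\zeta\in\partial\Omega$ $$0\le\mathbb{S}(t,x,y)\le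 C(t)\,\delta(x)^\gamma\delta(y)^\gamma,\qquad \int_\Omega\mathbb{S}(t,x,y)\,dx\le1,\qquad 0\le D_\gamma\mathbb{S}(t,\zeta,y)\le C(t)\,\delta(y)^\gamma .$$
   Context: Notation: $\delta(x)=\mathrm{dist}(x,\Omega^c)$ (while $\delta_y$ denotes the Dirac mass at $y$); $a\wedge b=\min(a,b)$; $\asymp$ means two-sided bounds by positive constants independent of $x,y$; $\delta^\gamma X=\{\delta^\gamma v:v\in X\}$ with norm $\|u\|_{\delta^\gamma X}=\|u/\delta^\gamma\|_X$. $\mathbb{G}:\Omega\times\Omega\to[0,\infty]$ is a measurable kernel and $\mathcal{G}[f](x)=\int_\Omega\mathbb{G}(x,y)f(y)\,dy$. Standing eigen-decomposition: $\mathcal{G}$ is a compact, self-adjoint, injective, positive operator on $L^2(\Omega)$, and there is an orthonormal basis $(\varphi_k)_{k\ge1}$ of $L^2(\Omega)$ with $\mathcal{G}[\varphi_k]=\lambda_k^{-1}\varphi_k$, $0<\lambda_1<\lambda_2\le\lambda_3\le\cdots\to\infty$. Under (1)–(2) it is known that $\varphi_1\asymp\delta^\gamma$ and $\varphi_k\in\delta^\gamma C(\overline\Omega)$. The heat semigroup on $L^2(\Omega)$ is $\mathcal{S}(t)[u_0]=\sum_{k\ge1}e^{-\lambda_kt}\langle u_0,\varphi_k\rangle\varphi_k$. $M(\Omega,\delta^\gamma)$ is the space of signed Radon measures $\mu$ on $\Omega$ with norm $\int_\Omega\delta^\gamma\,d|\mu|<\infty$. For $\mu\in M(\Omega,\delta^\gamma)$,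 $\mathcal{S}(t)[\mu]$ is the function whose coefficients in the basis $(\varphi_k)$ are $e^{-\lambda_kt}\int_\Omega\varphi_k\,d\mu$ (equivalently, the extension of $\mathcal{S}(t)$ by duality). Pointwise values of $\mathcal{S}(t)[\delta_y]$ are those of its continuous representative. Ultracontractive means that $\mathcal{S}(t):L^2(\Omega)\to L^\infty(\Omega)$ is bounded for every $t>0$. *)

(* Defs.v *)
From HB Require Import structures.
From mathcomp Require Import all_boot all_order all_algebra.
From mathcomp Require Import all_classical all_reals all_analysis.
From mathcomp Require Import measurable_realfun.
Set Implicit Arguments.
Unset Strict Implicit.
Unset Printing Implicit Defensive.
Import Order.TTheory GRing.Theory Num.Theory.
Import numFieldNormedType.Exports.
Local Open Scope classical_set_scope.
Local Open Scope ring_scope.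

(* Lebesgue measure is only needed on Borel sets: every Lebesgue measurable
   function agrees a.e. with a Borel one. *)
Section borel_rV.
Context {R : realType} (n : nat).
Local Notation E := 'rV[R]_n.

HB.instance Definition _ := @isMeasurable.Build
  (sigma_display (@open E)) E <<s @open E >>
  (@sigma_algebra0 _ setT (@open E)) (@sigma_algebraC _ (@open E))
  (@sigma_algebra_bigcup _ setT (@open E)).

Lemma open_measurable_rV (A : set E) : open A -> measurable A.
Proof. exact: sub_sigma_algebra. Qed.
End borel_rV.

Section lebesgue_tuple.
Context {R : realType}.
Local Notation V := (measurableTypeR R).

Section cons.
Variables (n : nat) (mu : {sigma_finite_measure set (n.-tuple V) -> \bar R}).

Definition tcons (p : V * n.-tuple V) : n.+1.-tuple V := [tuple of p.1 :: p.2].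

Lemma measurable_tcons : measurable_fun [set: V * n.-tuple V] tcons.
Proof. exact: measurable_cons. Qed.

Definition cons_measure : set (n.+1.-tuple V) -> \bar R :=
  pushforward (@lebesgue_measure R \x mu)%E tcons.

HB.instance Definition _ := Measure.copy cons_measure
  (@measure_function_pushforward__canonical__measure_function_Measure
    _ _ _ _ _ (@lebesgue_measure R \x mu)%E _ measurable_tcons).

Let tsplit (t : n.+1.-tuple V) : V * n.-tuple V :=
  (thead t, [tuple of behead t]).

Let cons_measure_sigma_finite : sigma_finite setT cons_measure.
Proof.
have [F [TF ndF Foo]] := iffLR (@sigma_finiteP _ _ _ _ _) (sigma_finiteT (@lebesgue_measure R)).
have [G [TG ndG Goo]] := iffLR (@sigma_finiteP _ _ _ _ _) (sigma_finiteT mu).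
have msplit : measurable_fun setT tsplit.
  by apply: measurable_fun_pair;
    [exact: measurable_tnth | exact: measurable_behead].
exists (fun k => tsplit @^-1` (F k `*` G k)).
  apply/seteqP; split => [t _|] //.
  have [i _ Fi] : (\bigcup_i F i) (tsplit t).1 by rewrite -TF.
  have [j _ Gj] : (\bigcup_i G i) (tsplit t).2 by rewrite -TG.
  exists (maxn i j) => //; split.
    by move: Fi; exact/subsetPset/ndF/leq_maxl.
  by move: Gj; exact/subsetPset/ndG/leq_maxr.
move=> k; have [mF Fk] := Foo k; have [mG Gk] := Goo k; split.
  by rewrite -[X in measurable X]setTI; apply: msplit => //; exact: measurableX.
rewrite /cons_measure /pushforward.
rewrite (_ : tcons @^-1` _ = F k `*` G k).
  by rewrite product_measure1E// lte_mul_pinfty// ge0_fin_numE.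
apply/seteqP; split => -[x t]; rewrite /= /tsplit /tcons theadE;
  (suff -> : [tuple of behead [tuple of x :: t]] = t by []); exact: val_inj.
Qed.

HB.instance Definition _ := @Measure_isSigmaFinite.Build _ _ _
  cons_measure cons_measure_sigma_finite.
End cons.

Let nil_measure : {sigma_finite_measure set (0.-tuple V) -> \bar R} :=
  \d_([tuple] : 0.-tuple V).

Fixpoint lebesgue_tuple n : {sigma_finite_measure set (n.-tuple V) -> \bar R} :=
  if n is m.+1 then cons_measure (lebesgue_tuple m) else nil_measure.

Lemma lebesgue_tuple_box n (A : 'I_n -> set V) :
  (forall i, measurable (A i)) ->
  lebesgue_tuple n [set t | forall i, A i (tnth t i)]
  = (\prod_(i < n) lebesgue_measure (A i))%E.
Proof.
elim: n A => [A _|n ih A mA].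
  by rewrite big_ord0 /= diracE mem_set// => -[].
rewrite big_ord_recl -(ih (fun i => A (lift ord0 i)))//.
rewrite -product_measure1E//; last first.
  rewrite (_ : mkset _ = \big[setI/setT]_i
      ((@tnth n V ^~ i) @^-1` (A (lift ord0 i)))).
    apply: big_rec => // i B _ mB; apply: measurableI => //.
    by rewrite -[X in measurable X]setTI; exact: measurable_tnth.
  rewrite -bigcap_seq; apply/seteqP; split => [t /= tB i _|t tB i].
    exact: tB.
  by apply: tB; rewrite /= mem_index_enum.
congr product_measure1; apply/seteqP; split => -[x t] /= => [xt|[Ax At] i].
  by split => [|i]; [have := xt ord0 | have := xt (lift ord0 i); rewrite tnthS].
by have [j ->|->] := unliftP ord0 i; rewrite ?tnthS.
Qed.
End lebesgue_tuple.

Section lebesgue_rV.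
Context {R : realType} (n : nat).
Local Notation E := 'rV[R]_n.
Local Notation V := (measurableTypeR R).

Definition row_of_tuple (t : n.-tuple V) : E := \row_i tnth t i.

Let rbox (q : 'rV[rat]_n) (k : nat) : set E :=
  [set x | forall i, `|ratr (q 0 i) - x 0 i| < k.+1%:R^-1].

Lemma measurable_row_of_tuple : measurable_fun [set: n.-tuple V] row_of_tuple.
Proof.
apply: measurability => [//|_ [A oA <-]].
rewrite setTI.
pose B (p : 'rV[rat]_n * nat) : set (n.-tuple V) :=
  if `[< rbox p.1 p.2 `<=` A >] then row_of_tuple @^-1` rbox p.1 p.2 else set0.
have -> : row_of_tuple @^-1` A = \bigcup_p B p.
  apply/seteqP; split => [t /= At|t [p _]]; last first.
    by rewrite /B; case: ifPn => // /asboolP BA /BA.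
  have /nbhs_ballP[e /= e0 eA] : nbhs (row_of_tuple t) A by exact: open_nbhs_nbhs.
  have [k ke] : exists k : nat, k.+1%:R^-1 < e / 2.
    have := @near_infty_natSinv_lt R (PosNum (divr_gt0 e0 (ltr0n R 2))).
    by move=> [k _ /(_ k (leqnn k))]; exists k.
  have /choice[q qP] : forall i, exists q : rat, `|ratr q - tnth t i| < k.+1%:R^-1.
    move=> i; have [||x [xB [q _ qx]]] := @dense_rat R (ball (tnth t i) k.+1%:R^-1).
    - by exists (tnth t i); apply: ballxx; rewrite invr_gt0.
    - by apply: ball_open; rewrite invr_gt0.
    - by exists q; rewrite qx distrC; exact: xB.
  exists (\row_i q i, k) => //; rewrite /B /=.
  have -> : `[< rbox (\row_i q i) k `<=` A >].
    apply/asboolP => x xB; apply: eA; split => // i j; rewrite /ball/= ord1 mxE.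
    have := xB j; rewrite mxE => xj.
    rewrite (splitr e) (le_lt_trans (ler_distD (ratr (q j)) _ _))// ltrD//.
      by rewrite distrC (lt_trans (qP j)).
    exact: lt_trans ke.
  by move=> i; rewrite /= !mxE.
apply: countable_bigcupT_measurable; first exact: countableP.
move=> [q k]; rewrite /B; case: ifPn => // _ /=.
rewrite (_ : _ @^-1` _ = \big[setI/setT]_i
    ((@tnth n V ^~ i) @^-1` (ball (ratr (q 0 i) : R) k.+1%:R^-1))); last first.
  rewrite -bigcap_seq; apply/seteqP; split => [t /= tB i _|t tB i].
    by have := tB i; rewrite mxE.
  by have := tB i; rewrite mxE; apply; rewrite /= mem_index_enum.
apply: big_rec => // i A' _ mA'; apply: measurableI => //.
rewrite -[X in measurable X]setTI; apply: measurable_tnth => //.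
by apply: open_measurable; apply: ball_open; rewrite invr_gt0.
Qed.

Definition lebesgue_rV : set E -> \bar R :=
  pushforward (@lebesgue_tuple R n) row_of_tuple.

HB.instance Definition _ := Measure.copy lebesgue_rV
  (@measure_function_pushforward__canonical__measure_function_Measure
    _ _ _ _ _ (@lebesgue_tuple R n) _ measurable_row_of_tuple).

Lemma lebesgue_rV_box (A : 'I_n -> set V) : (forall i, measurable (A i)) ->
  lebesgue_rV [set x | forall i, A i (x 0 i)]
  = (\prod_(i < n) lebesgue_measure (A i))%E.
Proof.
move=> mA; rewrite -lebesgue_tuple_box//; congr (lebesgue_tuple n _).
apply/seteqP; split => t /= tA i; have := tA i; rewrite ?mxE//.
Qed.
End lebesgue_rV.

Section domain.
Context {R : realType} (n : nat).
Local Notation E := 'rV[R]_n.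

(* The normed module structure on 'rV[R]_n is that of the sup norm; |x - y|
   and dist(x, Om^c) are Euclidean. *)
Definition enorm (x : E) : R := Num.sqrt (\sum_i x 0 i ^+ 2).

Record bounded_domain := BoundedDomain {
  dom :> set E ;
  dom_open : open dom ;
  dom_connected : connected dom ;
  dom_neq0 : dom !=set0 ;
  dom_bounded : bounded_set dom }.

Variable Om : bounded_domain.

Definition bdist (x : E) : R := inf [set enorm (x - z) | z in ~` Om].

Definition bdist_pow (gam : R) (x : E) : R := bdist x `^ gam.

Definition boundary (A : set E) : set E := closure A `\` interior A.

Definition leb : {measure set E -> \bar R} :=
  mrestr (@lebesgue_rV R n) (open_measurable_rV (@dom_open Om)).

(* Functions on Om are represented by functions on the whole of R^n whose
   values outside Om are irrelevant; classes modulo a.e. equality on Om are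
   handled through representatives. *)
Definition Lp (p : \bar R) : set (E -> R) := [set f | f \in Lfun leb p].

Definition Lp_norm (p : \bar R) (f : E -> R) : \bar R := 'N[leb]_p[EFin \o f]%E.

Definition inner (f g : E -> R) : R := (\int[leb]_x (f x * g x))%R.

Definition C_closure : set (E -> R) :=
  [set v | {within closure Om, continuous v}].

(* By density of Om this is the maximum over the closure. *)
Definition C_norm (v : E -> R) : \bar R :=
  ereal_sup [set `|v x|%:E | x in dom Om].

(* w X = {w v : v in X}, with distance |(u - u') / w|_X. *)
Definition wspace (w : E -> R) (X : set (E -> R)) : set (E -> R) :=
  [set u | exists2 v, X v & forall x, dom Om x -> u x = w x * v x].

Definition wdist (w : E -> R) (N : (E -> R) -> \bar R) (u u' : E -> R) : \bar R :=
  N (fun x => (u x - u' x) / w x).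

Definition Lp_dist (p : \bar R) (u u' : E -> R) : \bar R :=
  Lp_norm p (fun x => u x - u' x).

End domain.
Arguments bounded_domain R n : clear implicits.

(* T is the graph of a map: T a b means that b represents the image of a.
   Besides continuity, every a in X is required to have an image in Y. *)
Definition continuous_op {R : realType} {A B : Type}
    (X : set A) (dX : A -> A -> \bar R) (Y : set B) (dY : B -> B -> \bar R)
    (T : A -> B -> Prop) : Prop :=
  forall a, X a -> (exists2 b, Y b & T a b) /\
    forall b, Y b -> T a b -> forall e : R, 0 < e ->
      exists2 d : R, 0 < d &
        forall a' b', X a' -> Y b' -> T a' b' ->
          (dX a a' < d%:E)%E -> (dY b b' < e%:E)%E.

Section green.
Context {R : realType} (n : nat).
Local Notation E := 'rV[R]_n.
Variables (Om : bounded_domain R n) (G : E -> E -> \bar R).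
Local Notation mu := (leb Om).
Local Notation L2 := (Lp Om 2%:E).
Local Notation norm2 := (Lp_norm Om 2%:E).

(* The value 0 outside Om only serves to make green_op f measurable on R^n. *)
Definition green_op (f : E -> R) : E -> R :=
  patch (cst 0) Om
    (fun x => fine (\int[@lebesgue_rV R n]_(y in Om) (G x y * (f y)%:E))%E).

Definition green_graph (f v : E -> R) : Prop :=
  forall x, dom Om x -> v x = green_op f x.

(* The eigenpair (phi_{k+1}, lambda_{k+1}) is (phi k, lam k). *)
Record green_eigensystem (phi : nat -> E -> R) (lam : nat -> R) : Prop := {
  green_measurable : measurable_fun (Om `*` Om) (fun p : E * E => G p.1 p.2) ;
  green_ge0 : forall x y, dom Om x -> dom Om y -> (0 <= G x y)%E ;
  green_integrable : forall f, L2 f -> \forall x \ae mu,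
    (@lebesgue_rV R n).-integrable Om (fun y => G x y * (f y)%:E)%E ;
  green_L2 : forall f, L2 f -> L2 (green_op f) ;
  green_compact : forall f : nat -> E -> R, (forall k, L2 (f k)) ->
    (exists M : R, forall k, (norm2 (f k) <= M%:E)%E) ->
    exists (sigma : nat -> nat) (g : E -> R),
      [/\ {homo sigma : i j / (i < j)%N}, L2 g &
          norm2 (fun x => green_op (f (sigma k)) x - g x) @[k --> \oo] --> 0%E] ;
  green_selfadjoint : forall f g, L2 f -> L2 g ->
    inner Om (green_op f) g = inner Om f (green_op g) ;
  green_injective : forall f, L2 f ->
    green_op f = cst 0 %[ae mu] -> f = cst 0 %[ae mu] ;
  green_positive : forall f, L2 f -> 0 <= inner Om (green_op f) f ;
  eigen_L2 : forall k, L2 (phi k) ;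
  eigen_orthonormal : forall j k, inner Om (phi j) (phi k) = (j == k)%:R ;
  eigen_basis : forall f, L2 f ->
    norm2 (fun x => f x - \sum_(k < N) inner Om f (phi k) * phi k x)
      @[N --> \oo] --> 0%E ;
  eigenE : forall k, green_op (phi k) = (fun x => (lam k)^-1 * phi k x) %[ae mu] ;
  eigen_gt0 : 0 < lam 0%N ;
  eigen_gap : lam 0%N < lam 1%N ;
  eigen_mono : forall k, lam k <= lam k.+1 ;
  eigen_unbounded : lam k @[k --> \oo] --> +oo%R }.

Definition green_profile (s gam : R) (x y : E) : R :=
  enorm (x - y) `^ (- (n%:R - 2 * s)) *
  Num.min (bdist Om x * bdist Om y / enorm (x - y) ^+ 2) 1 `^ gam.

Definition green_estimate (s gam : R) : Prop :=
  (forall x y, dom Om x -> dom Om y -> x != y -> G x y = G y x) /\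
  exists c C : R, [/\ 0 < c, 0 < C &
    forall x y, dom Om x -> dom Om y -> x != y ->
      ((c * green_profile s gam x y)%:E <= G x y <=
       (C * green_profile s gam x y)%:E)%E].

End green.

Section signed_measures.
Context {R : realType} (n : nat).
Local Notation E := 'rV[R]_n.

(* A signed Radon measure on Om need not have finite total variation, so it is
   represented by its Jordan decomposition, a pair of Borel measures on R^n
   carried by Om; its total variation is the sum of the two. *)
Record signed_measure := SignedMeasure {
  smpos : {measure set E -> \bar R} ;
  smneg : {measure set E -> \bar R} }.

Variable Om : bounded_domain R n.

Definition signed_radon (mu : signed_measure) : Prop :=
  [/\ smpos mu (~` Om) = 0%E /\ smneg mu (~` Om) = 0%E,
      forall K, compact K -> K `<=` Om ->
        (smpos mu K < +oo)%E /\ (smneg mu K < +oo)%E &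
      exists A, [/\ measurable A, smpos mu A = 0%E & smneg mu (~` A) = 0%E]].

Definition M_norm (w : E -> R) (mu : signed_measure) : \bar R :=
  (\int[smpos mu]_(x in Om) (w x)%:E + \int[smneg mu]_(x in Om) (w x)%:E)%E.

Definition M_space (w : E -> R) : set signed_measure :=
  [set mu | signed_radon mu /\ (M_norm w mu < +oo)%E].

Definition sm_integral (mu : signed_measure) (f : E -> R) : R :=
  (\int[smpos mu]_(x in Om) f x - \int[smneg mu]_(x in Om) f x)%R.

(* rho = mu - nu, with all terms brought to the side where they are positive. *)
Definition is_difference (mu nu rho : signed_measure) : Prop :=
  forall A, measurable A ->
    (smpos rho A + smneg mu A + smpos nu A =
     smneg rho A + smpos mu A + smneg nu A)%E.

(* The difference rho is unique, so this is its norm. *)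
Definition M_dist (w : E -> R) (mu nu : signed_measure) : \bar R :=
  ereal_inf [set M_norm w rho | rho in
    [set rho | M_space w rho /\ is_difference mu nu rho]].

Definition dirac_sm (y : E) : signed_measure :=
  SignedMeasure (@dirac _ E y R) (@mzero _ E R).

End signed_measures.

Section heat.
Context {R : realType} (n : nat).
Local Notation E := 'rV[R]_n.
Variables (Om : bounded_domain R n) (gam : R).
Variables (phi : nat -> E -> R) (lam : nat -> R).
Local Notation L2 := (Lp Om 2%:E).
Local Notation norm2 := (Lp_norm Om 2%:E).
Local Notation w := (bdist_pow Om gam).

(* u represents S(t)[u0]; the series converges in L^2(Om). *)
Definition heat (t : R) (u0 u : E -> R) : Prop :=
  L2 u /\
  norm2 (fun x => u x -
      \sum_(k < N) expR (- lam k * t) * inner Om u0 (phi k) * phi k x)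
    @[N --> \oo] --> 0%E.

(* u represents S(t)[mu]. The eigenfunctions are integrated against mu through
   their representatives in delta^gam C(closure Om). *)
Definition heat_measure (t : R) (mu : signed_measure n) (u : E -> R) : Prop :=
  L2 u /\ forall k, exists psi : E -> R,
    [/\ wspace Om w (C_closure Om) psi, psi = phi k %[ae leb Om] &
        inner Om u (phi k) = expR (- lam k * t) * sm_integral Om mu psi].

Definition submarkovian : Prop :=
  forall t u0 u, 0 <= t -> L2 u0 -> (\forall x \ae leb Om, 0 <= u0 x <= 1) ->
    heat t u0 u -> \forall x \ae leb Om, 0 <= u x <= 1.

Definition ultracontractive : Prop :=
  forall t, 0 < t -> exists2 C : R, 0 < C &
    forall u0, L2 u0 -> exists u,
      [/\ heat t u0 u, Lp Om +oo%E u &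
          (Lp_norm Om +oo%E u <= C%:E * norm2 u0)%E].

(* S t x y is the heat kernel. *)
Definition heat_kernel (S : R -> E -> E -> R) : Prop :=
  forall t y, 0 < t -> dom Om y ->
    heat_measure t (dirac_sm y) (fun x => S t x y) /\
    {within Om, continuous (fun x => S t x y)}.

Definition normal_quotient (f : E -> R) (zeta : E) : set_system R :=
  (f x / w x) @[x --> within Om (nbhs zeta)].

Definition normal_derivative (f : E -> R) (zeta : E) : R :=
  lim (normal_quotient f zeta).

End heat.

(* Main.v *)
Require Import Defs.
From mathcomp Require Import all_boot all_order all_algebra.
From mathcomp Require Import all_classical all_reals all_analysis.
From mathcomp Require Import measurable_realfun ring lra.
Set Implicit Arguments.
Unset Strict Implicit.
Unset Printing Implicit Defensive.
Import Order.TTheory GRing.Theory Num.Theory.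
Import numFieldNormedType.Exports.
Local Open Scope classical_set_scope.
Local Open Scope ring_scope.

(* By the two-sided Green estimate, one application of the Green operator G acts
   like a Riesz potential and moreover gains [s] in the exponent of the boundary
   weight, so some iterate maps L^2 into delta^gamma L^infty and the next one,
   by hypothesis (2), into delta^gamma C(closure Om). Hence, for a suitable N,
   psi_k = lambda_k^N G^N phi_k is a representative of phi_k with
   |psi_k| <= C lambda_k^N delta^gamma. Bounding G^N at x on the finite sums
   sum_k lambda_k^(-N) psi_k(x) phi_k gives
     sum_k lambda_k^(-2N) psi_k(x)^2 <= C^2 delta(x)^(2 gamma),
   and integrating in x, sum_k lambda_k^(-2N) < oo. This takes the place of
   Weyl's law: sum_k exp(-lambda_k t) lambda_k^q < oo for all t > 0 and q, so
   every series sum_k exp(-lambda_k t) c_k psi_k with |c_k| <= A lambda_k^N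
   converges absolutely in delta^gamma C(closure Om). The coefficients of an
   L^2 function, of a measure in M(Om, delta^gamma) and of a Dirac mass all have
   this growth, which yields the mapping properties, the heat kernel and its
   normal derivative. The sign and the mass of the kernel follow from (3) by the
   symmetry of S(t), since data are evaluated at points of the domain through
   the continuous representative. *)

(** Regularity is gained without a scale of L^p spaces: iterates of the Green operator are dominated
    pointwise by explicit Riesz kernels. The order [2 s] of the kernel is split. One half pays for a
    gain of [s] in the weight exponent, until it saturates at [gam]; the other half leaves a kernel
    of order [s]. Composing that kernel with an earlier one lowers the singularity exponent by
    [s / 2] only, because the remaining [s / 2] keeps the kernels |x - z|^(-(n - s/2)) integrable.
    Once the exponent reaches zero, only the L^1 norm of the datum is left, and the L^2 norm bounds
    it. The recurrent obstacle is that L^2 identities hold almost everywhere, while kernel values,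
    Dirac masses and boundary limits are pointwise: [green_op] is linear only almost everywhere, and
    [phi k] is an arbitrary member of its class. Pointwise identities are therefore obtained either
    between continuous functions that agree almost everywhere, or termwise on partial sums, with a
    tail estimate uniform in the coefficients and in the point. *)

(** * Real inner product and norm on L^2, orthonormal sums *)

Section square_integrable.
Context d (T : measurableType d) (R : realType).
Variable mu : {measure set T -> \bar R}.
Implicit Types f g h : T -> R.
Local Notation L2 := (Lfun mu 2%:E).
Local Notation ip f g := (\int[mu]_x (f x * g x)).

Definition rnorm2 f : R := Num.sqrt (ip f f).

Lemma Lfun_measurable (p : \bar R) f : f \in Lfun mu p -> measurable_fun setT f.
Proof. by move=> /andP[/[!inE]]. Qed.

Lemma Lfun2P f : f \in L2 <->
  measurable_fun setT f /\ mu.-integrable setT (fun x => (f x ^+ 2)%:E).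
Proof.
split=> [fL|[mf /integrableP[_ fi]]].
  by split; [exact: Lfun_measurable fL | exact: Lfun2_integrable_sqr].
apply/andP; split; rewrite inE//=; rewrite /finite_norm unlock poweR_lty//.
apply: le_lt_trans fi; rewrite le_eqVlt; apply/orP; left; apply/eqP.
apply: eq_integral => x _.
by rewrite !abse_EFin poweR_EFin powR_mulrn// normrX.
Qed.

Lemma Lfun2D f g : f \in L2 -> g \in L2 -> (fun x => f x + g x) \in L2.
Proof.
by move=> fL gL; apply: (Lfun_addr_closed mu (lee1n 2)).2.
Qed.

Lemma Lfun2Z a f : f \in L2 -> (fun x => a * f x) \in L2.
Proof.
move=> fL; rewrite (_ : (fun x => _) = a \o* f).
  by apply: Lfun_scale => //; rewrite ler1n.
by apply/funext => x /=; rewrite mulrC.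
Qed.

Lemma Lfun2B f g : f \in L2 -> g \in L2 -> (fun x => f x - g x) \in L2.
Proof.
move=> fL gL; rewrite (_ : (fun x => _) = fun x => f x + (-1) * g x).
  by apply: Lfun2D => //; exact: Lfun2Z.
by apply/funext => x; rewrite mulN1r.
Qed.

Lemma Lfun2_sum (e : nat -> T -> R) (a : nat -> R) N :
  (forall k, e k \in L2) -> (fun x => \sum_(k < N) a k * e k x) \in L2.
Proof.
move=> eL; elim: N => [|N ih].
  rewrite (_ : (fun x => _) = cst 0).
    exact: (Lfun_addr_closed mu (lee1n 2)).1.
  by apply/funext => x; rewrite big_ord0.
rewrite (_ : (fun x => _) =
    fun x => \sum_(k < N) a k * e k x + a N * e N x).
  by apply: Lfun2D => //; exact: Lfun2Z.
by apply/funext => x; rewrite big_ord_recr.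
Qed.

Lemma Lfun2_integrableM f g : f \in L2 -> g \in L2 ->
  mu.-integrable setT (fun x => (f x * g x)%:E).
Proof. by move=> fL gL; apply/Lfun1_integrable/Lfun2_mul_Lfun1. Qed.

Lemma ip_ge0 f : 0 <= ip f f.
Proof. by apply: Rintegral_ge0 => x _; exact: mulr_ge0_norm || rewrite -expr2 sqr_ge0. Qed.

Lemma rnorm2_ge0 f : 0 <= rnorm2 f. Proof. exact: sqrtr_ge0. Qed.

Lemma rnorm2_sqr f : rnorm2 f ^+ 2 = ip f f.
Proof. by rewrite sqr_sqrtr// ip_ge0. Qed.

Lemma Lnorm2E f : f \in L2 -> 'N[mu]_2%:E[EFin \o f]%E = (rnorm2 f)%:E.
Proof.
move=> /Lfun2P[mf fi]; rewrite unlock.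
have -> : (\int[mu]_x (`|(EFin \o f) x| `^ 2))%E = (ip f f)%:E.
  rewrite /Rintegral fineK; last first.
    under eq_integral do rewrite -expr2.
    by apply: integrable_fin_num.
  apply: eq_integral => x _.
  by rewrite !abse_EFin poweR_EFin powR_mulrn// -normrX expr2 ger0_norm// -expr2 sqr_ge0.
by rewrite poweR_EFin /rnorm2 -powR12_sqrt ?ip_ge0// [in RHS]mulrC.
Qed.

Lemma EFin_ip f : f \in L2 -> (ip f f)%:E = (\int[mu]_x (f x ^+ 2)%:E)%E.
Proof.
move=> /Lfun2P[mf fi]; rewrite -(fineK (integrable_fin_num measurableT fi)).
by congr (fine _)%:E; apply: eq_integral => x _; rewrite expr2.
Qed.

Lemma ipC f g : ip f g = ip g f.
Proof. by apply: eq_Rintegral => x _; rewrite mulrC. Qed.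

Lemma ipDl f g h : f \in L2 -> g \in L2 -> h \in L2 ->
  ip (fun x => f x + g x) h = ip f h + ip g h.
Proof.
move=> fL gL hL; rewrite -RintegralD//; [|exact: Lfun2_integrableM..].
by apply: eq_Rintegral => x _; rewrite mulrDl.
Qed.

Lemma ipZl a f h : f \in L2 -> h \in L2 -> ip (fun x => a * f x) h = a * ip f h.
Proof.
move=> fL hL; rewrite -RintegralZl//; last exact: Lfun2_integrableM.
by apply: eq_Rintegral => x _; rewrite mulrA.
Qed.

Lemma ipBl f g h : f \in L2 -> g \in L2 -> h \in L2 ->
  ip (fun x => f x - g x) h = ip f h - ip g h.
Proof.
move=> fL gL hL; rewrite -RintegralB//; [|exact: Lfun2_integrableM..].
by apply: eq_Rintegral => x _; rewrite mulrBl.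
Qed.

Lemma ip_suml (e : nat -> T -> R) (a : nat -> R) N h :
  (forall k, e k \in L2) -> h \in L2 ->
  ip (fun x => \sum_(k < N) a k * e k x) h = \sum_(k < N) a k * ip (e k) h.
Proof.
move=> eL hL; elim: N => [|N ih].
  rewrite big_ord0 -[RHS](mul0r (fine (mu setT))) -Rintegral_cst//.
  by apply: eq_Rintegral => x _; rewrite big_ord0 mul0r.
rewrite big_ord_recr /= -ih -ipZl// -ipDl//; last 2 first.
- exact: Lfun2_sum.
- exact: Lfun2Z.
by apply: eq_Rintegral => x _; rewrite big_ord_recr.
Qed.

Lemma ae_eq_ipl f g h : f \in L2 -> g \in L2 -> h \in L2 ->
  f = g %[ae mu] -> ip f h = ip g h.
Proof.
move=> fL gL hL fg; congr fine; apply: ae_eq_integral => //.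
- by case/integrableP: (Lfun2_integrableM fL hL).
- by case/integrableP: (Lfun2_integrableM gL hL).
- by apply: filterS fg => x /= + _ => /(_ I) ->.
Qed.

Lemma ip_CauchySchwarz f g : f \in L2 -> g \in L2 ->
  `|ip f g| <= rnorm2 f * rnorm2 g.
Proof.
move=> fL gL.
rewrite -lee_fin EFinM -!Lnorm2E// EFin_normr_Rintegral//; last exact: Lfun2_integrableM.
have h := @hoelder _ _ _ mu f g 2 2 (Lfun_measurable fL) (Lfun_measurable gL).
apply: le_trans (h _ _ _) => //; last by rewrite [RHS]splitr !div1r.
rewrite Lnorm1; apply: le_abse_integral => //.
by case/integrableP: (Lfun2_integrableM fL gL).
Qed.

Lemma rnorm2D f g : f \in L2 -> g \in L2 ->
  rnorm2 (fun x => f x + g x) <= rnorm2 f + rnorm2 g.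
Proof.
move=> fL gL; rewrite -lee_fin EFinD -!Lnorm2E//; last exact: Lfun2D.
apply: minkowski_EFin; [exact: Lfun_measurable fL | exact: Lfun_measurable gL|].
by rewrite ler1n.
Qed.

Lemma rnorm2_eq0 f : f \in L2 -> rnorm2 f = 0 -> f = cst 0 %[ae mu].
Proof.
move=> fL f0.
have mf : measurable_fun setT (EFin \o f).
  by apply/measurable_EFinP; exact: Lfun_measurable fL.
have := @Lnorm_eq0_eq0 _ _ _ mu _ 2%:E mf.
rewrite Lnorm2E// f0 lte_fin => /(_ (ltr0n _ 2) erefl).
by apply: filterS => x /= /(_ I)[].
Qed.

Lemma rnorm2_le_bound f g (a : R) : 0 <= a -> f \in L2 -> g \in L2 ->
  (\forall x \ae mu, `|f x| <= a * g x) -> rnorm2 f <= a * rnorm2 g.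
Proof.
move=> a0 fL gL fg.
rewrite -(ler_pXn2r (ltn0Sn 1)) ?nnegrE ?mulr_ge0 ?rnorm2_ge0//.
have agL := Lfun2Z a gL.
rewrite exprMn !rnorm2_sqr [a ^+ 2]expr2 -mulrA -(ipZl a gL gL) ipC -ipZl//.
rewrite ipC -lee_fin !EFin_ip//.
apply: ae_ge0_le_integral => //.
- by move=> x _; rewrite lee_fin sqr_ge0.
- by case/Lfun2P: fL => mf _; apply/measurable_EFinP; exact: measurable_funX.
- by move=> x _; rewrite lee_fin sqr_ge0.
- by case/Lfun2P: agL => mf _; apply/measurable_EFinP; exact: measurable_funX.
apply: filterS fg => x fgx _; rewrite lee_fin -real_normK ?num_real//.
by rewrite ler_pXn2r ?nnegrE// (le_trans _ fgx).
Qed.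

Section orthonormal.
Variable e : nat -> T -> R.
Hypothesis eL : forall k, e k \in L2.
Hypothesis e_on : forall j k, ip (e j) (e k) = (j == k)%:R.

Lemma ip_orthonormal_sum (a : nat -> R) N k :
  ip (fun x => \sum_(j < N) a j * e j x) (e k) = (k < N)%:R * a k.
Proof.
rewrite ip_suml//; case: (ltnP k N) => kN; rewrite ?mul1r ?mul0r.
  rewrite (bigD1 (Ordinal kN))//= e_on eqxx mulr1 big1 ?addr0// => j jk.
  rewrite e_on; case: eqP => [jk'|_]; rewrite ?mulr0//.
  by move: jk; rewrite -val_eqE /= jk' eqxx.
rewrite big1// => j _; rewrite e_on; case: eqP => [jk|_]; rewrite ?mulr0//.
by have := ltn_ord j; rewrite jk ltnNge kN.
Qed.

Lemma rnorm2_orthonormal_sum (a : nat -> R) N :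
  rnorm2 (fun x => \sum_(j < N) a j * e j x) ^+ 2 = \sum_(j < N) a j ^+ 2.
Proof.
rewrite rnorm2_sqr ip_suml//; last exact: Lfun2_sum.
by apply: eq_bigr => j _; rewrite ipC ip_orthonormal_sum ltn_ord mul1r.
Qed.

Lemma ip_orthonormal_le f k : f \in L2 -> `|ip f (e k)| <= rnorm2 f.
Proof.
move=> fL; apply: le_trans (ip_CauchySchwarz fL (eL k)) _.
by rewrite /rnorm2 e_on eqxx sqrtr1 mulr1.
Qed.

(** Half of Parseval's identity: the remainder of the expansion drops below any [eps], and the
    partial sum has norm at most [B] by orthonormality. It bounds a function of which only the
    coefficients are known. *)
Lemma rnorm2_le_coef f (B : R) : f \in L2 -> 0 <= B ->
  'N[mu]_2%:E[EFin \o (fun x => f x - \sum_(k < N) ip f (e k) * e k x)%R]%E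
    @[N --> \oo] --> 0%E ->
  (forall N, \sum_(k < N) (ip f (e k)) ^+ 2 <= B ^+ 2) -> rnorm2 f <= B.
Proof.
move=> fL B0 fe fB; apply/ler_addgt0Pr => eps eps0.
have [N _ /(_ N (leqnn N))] : \forall N \near \oo,
    ('N[mu]_2%:E[EFin \o (fun x => f x - \sum_(k < N) ip f (e k) * e k x)%R] <
     eps%:E)%E.
  apply: (fe [set x | (x < eps%:E)%E]); apply: open_nbhs_nbhs; split;
    [exact: open_ereal_lt_ereal | by rewrite /= lte_fin].
have sL : (fun x => \sum_(k < N) ip f (e k) * e k x) \in L2.
  exact: (Lfun2_sum (fun k => ip f (e k))).
rewrite /= Lnorm2E ?lte_fin//; last exact: Lfun2B.
move=> /ltW fN.
rewrite [X in rnorm2 X](_ : f = fun x => (f x - \sum_(k < N) ip f (e k) * e k x) + \sum_(k < N) ip f (e k) * e k x); last first.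
  by apply/funext => x; rewrite subrK.
apply: le_trans (rnorm2D _ sL) _; first exact: Lfun2B.
rewrite addrC lerD// -(ler_pXn2r (ltn0Sn 1)) ?nnegrE ?rnorm2_ge0//.
by rewrite (rnorm2_orthonormal_sum (fun k => ip f (e k))).
Qed.

End orthonormal.

End square_integrable.

(** * The Euclidean norm on row vectors and Borel measurability *)

Section euclidean_norm.
Context {R : realType} {n : nat}.
Implicit Types x y z : 'rV[R]_n.

Lemma enorm_ge0 x : 0 <= enorm x. Proof. exact: sqrtr_ge0. Qed.

Lemma enorm_sqr x : enorm x ^+ 2 = \sum_i x 0 i ^+ 2.
Proof. by rewrite sqr_sqrtr// sumr_ge0// => i _; exact: sqr_ge0. Qed.

Lemma coord_le_enorm x i : `|x 0 i| <= enorm x.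
Proof.
rewrite -(ler_pXn2r (ltn0Sn 1)) ?nnegrE ?enorm_ge0// enorm_sqr (bigD1 i)//=.
by rewrite real_normK ?num_real// lerDl sumr_ge0// => j _; exact: sqr_ge0.
Qed.

Lemma enorm_eq0 x : enorm x = 0 -> x = 0.
Proof.
move=> x0; apply/rowP => i; rewrite mxE; apply/eqP.
by rewrite -normr_le0 -x0 coord_le_enorm.
Qed.

Lemma enorm_gt0 x : x != 0 -> 0 < enorm x.
Proof.
by move=> x0; rewrite lt_neqAle enorm_ge0 andbT eq_sym; apply: contra_neq x0 => /enorm_eq0.
Qed.

Lemma enormN x : enorm (- x) = enorm x.
Proof. by congr Num.sqrt; apply: eq_bigr => i _; rewrite mxE sqrrN. Qed.

Lemma enormB x y : enorm (x - y) = enorm (y - x).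
Proof. by rewrite -enormN opprB. Qed.

Lemma enorm_le x (M : R) : (forall i, `|x 0 i| <= M) -> enorm x <= n%:R * M.
Proof.
move=> xM; have [n0|n0] := posnP n.
  rewrite /enorm big1 ?sqrtr0 ?n0 ?mul0r// => i _.
  by have := ltn_ord i; rewrite [X in (_ < X)%N]n0.
have M0 : 0 <= M by exact: le_trans (normr_ge0 _) (xM (Ordinal n0)).
rewrite -(ler_pXn2r (ltn0Sn 1)) ?nnegrE ?enorm_ge0 ?mulr_ge0// enorm_sqr.
apply: (@le_trans _ _ (\sum_(i < n) M ^+ 2)).
  apply: ler_sum => i _; rewrite -real_normK ?num_real//.
  by rewrite ler_pXn2r ?nnegrE.
rewrite sumr_const card_ord exprMn -[leLHS]mulr_natl ler_wpM2r ?sqr_ge0//.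
by rewrite expr2 -natrM ler_nat leq_pmulr.
Qed.

Lemma enorm_CauchySchwarz x y : \sum_i x 0 i * y 0 i <= enorm x * enorm y.
Proof.
have [x0|x0] := eqVneq (enorm x) 0.
  rewrite x0 mul0r big1// => i _.
  by rewrite (enorm_eq0 x0) mxE mul0r.
have [y0|y0] := eqVneq (enorm y) 0.
  rewrite y0 mulr0 big1// => i _.
  by rewrite (enorm_eq0 y0) mxE mulr0.
have xp : 0 < enorm x by rewrite lt_neqAle eq_sym x0 enorm_ge0.
have yp : 0 < enorm y by rewrite lt_neqAle eq_sym y0 enorm_ge0.
(* This sum of squares equals 2 |x| |y| (|x| |y| - x.y), whose prefactor is positive. *)
have : 0 <= \sum_i (enorm y * x 0 i - enorm x * y 0 i) ^+ 2.
  by apply: sumr_ge0 => i _; exact: sqr_ge0.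
have -> : \sum_i (enorm y * x 0 i - enorm x * y 0 i) ^+ 2 =
    enorm y ^+ 2 * (\sum_i x 0 i ^+ 2) + enorm x ^+ 2 * (\sum_i y 0 i ^+ 2)
    - 2 * enorm x * enorm y * \sum_i x 0 i * y 0 i.
  rewrite !mulr_sumr -big_split/= -sumrB; apply: eq_bigr => i _; ring.
rewrite -!enorm_sqr.
set S := \sum_i _ => h.
have : 0 <= (2 * enorm x * enorm y) * (enorm x * enorm y - S).
  apply: le_trans h _; rewrite le_eqVlt; apply/orP; left; apply/eqP; ring.
by rewrite pmulr_rge0 ?mulr_gt0// subr_ge0.
Qed.

Lemma enormD x y : enorm (x + y) <= enorm x + enorm y.
Proof.
rewrite -(ler_pXn2r (ltn0Sn 1)) ?nnegrE ?addr_ge0 ?enorm_ge0// enorm_sqr.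
have -> : \sum_i (x + y) 0 i ^+ 2 = \sum_i x 0 i ^+ 2 + \sum_i y 0 i ^+ 2 +
    2 * \sum_i x 0 i * y 0 i.
  rewrite mulr_sumr -!big_split/=; apply: eq_bigr => i _; rewrite mxE; ring.
rewrite -!enorm_sqr sqrrD.
by have := enorm_CauchySchwarz x y; lra.
Qed.

Lemma enorm_triangle y x z : enorm (x - z) <= enorm (x - y) + enorm (y - z).
Proof. by rewrite (_ : x - z = (x - y) + (y - z)) ?enormD// addrA subrK. Qed.

Lemma enorm_lipschitz_continuous (f : 'rV[R]_n -> R) :
  (forall x y, f x <= f y + enorm (x - y)) -> continuous f.
Proof.
move=> fL x; apply: (iffRL (@cvgrPdist_lt R R^o _ (nbhs x) (nbhs_filter x) f (f x))) => e e0.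
(* Neighbourhoods are those of the sup norm, and the Euclidean norm is at most [n] times it; [n.+1]
   covers [n = 0] and makes the final inequality strict. *)
have d0 : 0 < e / n.+1%:R by rewrite divr_gt0.
apply/nbhs_ballP; exists (e / n.+1%:R) => //= y [_ xyb].
have xy : enorm (x - y) < e.
  apply: (@le_lt_trans _ _ (n%:R * (e / n.+1%:R))).
    by apply: enorm_le => i; have := xyb 0 i; rewrite /ball/= !mxE => /ltW.
  rewrite mulrCA gtr_pMr// ltr_pdivrMr// mul1r ltr_nat//.
have h1 := fL x y; have h2 := fL y x; rewrite enormB in h2.
by rewrite ltr_norml; apply/andP; split; lra.
Qed.

Lemma continuous_enormB y : continuous (fun x => enorm (x - y)).
Proof.
apply: enorm_lipschitz_continuous => x z.
by rewrite [leRHS]addrC; exact: enorm_triangle.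
Qed.

Lemma measurable_fun_open_continuous (D : set 'rV[R]_n) (f : 'rV[R]_n -> R) :
  open D -> {within D, continuous f} -> measurable_fun D f.
Proof.
move=> oD cf; apply: (measurability (@RGenOInfty.G R)).
  exact: RGenOInfty.measurableE.
move=> _ [_ [a ->] <-]; apply: open_measurable_rV.
have openI (S : set 'rV[R]_n) : S `<=` S^° -> open S by rewrite openE.
apply: openI => x [Dx /=]; rewrite in_itv/= andbT => fx.
have := cf; rewrite continuous_open_subspace// => /(_ x (mem_set Dx)).
move=> /(iffLR (@cvgrPdist_lt R R^o _ (nbhs x) (nbhs_filter x) f (f x))) /(_ (f x - a)).
rewrite subr_gt0 => /(_ fx) fxa.
apply: filterS (filterI (open_nbhs_nbhs (conj oD Dx)) fxa) => y [Dy fy].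
split => //; rewrite /= in_itv/= andbT.
by move: fy; rewrite ltr_norml => /andP[_]; rewrite ltrD2l ltrN2.
Qed.

Lemma continuous_measurable_fun_rV (f : 'rV[R]_n -> R) :
  continuous f -> measurable_fun setT f.
Proof.
by move=> cf; apply: measurable_fun_open_continuous; [exact: openT|exact: continuous_subspaceT].
Qed.

(** The product carries the product sigma-algebra, to which joint continuity does not apply
    directly; measurability is assembled from the coordinates. *)
Lemma measurable_enormB :
  measurable_fun setT (fun p : 'rV[R]_n * 'rV[R]_n => enorm (p.1 - p.2)).
Proof.
apply: (measurableT_comp (f := @Num.sqrt R)).
  by apply: measurable_funTS; apply: continuous_measurable_fun; exact: sqrt_continuous.
have mc (i : 'I_n) : measurable_fun setT (fun x : 'rV[R]_n => x 0 i).
  by apply: continuous_measurable_fun_rV; exact: coord_continuous.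
apply: measurable_sum => i; apply: measurable_funX.
have : measurable_fun setT (fun p : 'rV[R]_n * 'rV[R]_n => p.1 0 i - p.2 0 i).
  apply: measurable_funB.
    exact: (measurableT_comp (mc i) measurable_fst).
  exact: (measurableT_comp (mc i) measurable_snd).
by apply: eq_measurable_fun => p _; rewrite !mxE.
Qed.

End euclidean_norm.

(** * Distance to the complement and its powers *)

Section boundary_distance.
Context {R : realType} {n : nat}.
Variable Om : bounded_domain R n.
Implicit Types x y z : 'rV[R]_n.

Lemma dom_coord_bounded : exists2 M : R, 0 < M &
  forall x, dom Om x -> forall i, `|x 0 i| <= M.
Proof.
have [M0 [_ /(_ (Num.max M0 0 + 1)) h]] := dom_bounded Om.
exists (Num.max M0 0 + 1); first by rewrite ltr_pwDr// le_max lexx orbT.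
move=> x Ox i.
have := h _ x Ox; rewrite ltr_pwDr// ?le_max ?lexx// => /(_ isT).
apply: le_trans; rewrite /Num.norm/= mx_normrE.
exact: (le_bigmax _ (fun ij => `|x ij.1 ij.2|) (0, i)).
Qed.

Hypothesis n0 : (0 < n)%N.

(** In dimension zero a nonempty domain is the whole space, and [bdist] would be the infimum of an
    empty set; this is where [n0] enters. *)
Lemma dom_complement_neq0 : exists z, ~ dom Om z.
Proof.
have [M M0 OM] := dom_coord_bounded.
exists (const_mx (M + 1)) => /OM /(_ (Ordinal n0)).
by rewrite mxE ger0_norm ?addr_ge0 ?(ltW M0)// leNgt ltrDl ltr01.
Qed.

Let dset x := [set enorm (x - z) | z in ~` (Om : set _)].

Let dset0 x : dset x !=set0.
Proof. by have [z Oz] := dom_complement_neq0; exists (enorm (x - z)), z. Qed.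

Let dset_lb x : lbound (dset x) 0.
Proof. by move=> _ [z _ <-]; exact: enorm_ge0. Qed.

Lemma bdist_le x z : ~ dom Om z -> bdist Om x <= enorm (x - z).
Proof. by move=> Oz; apply: ge_inf; [exists 0; exact: dset_lb | exists z]. Qed.

Lemma bdist_ge x (r : R) :
  (forall z, ~ dom Om z -> r <= enorm (x - z)) -> r <= bdist Om x.
Proof. by move=> rx; apply: lb_le_inf (dset0 x) _ => _ [z Oz <-]; exact: rx. Qed.

Lemma bdist_ge0 x : 0 <= bdist Om x.
Proof. by apply: bdist_ge => z _; exact: enorm_ge0. Qed.

Lemma bdist_lipschitz x y : bdist Om x <= bdist Om y + enorm (x - y).
Proof.
rewrite -lerBlDr; apply: bdist_ge => z Oz; rewrite lerBlDr addrC.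
exact: le_trans (bdist_le x Oz) (enorm_triangle _ _ _).
Qed.

Lemma bdist_gt0 x : dom Om x -> 0 < bdist Om x.
Proof.
move=> Ox; have /nbhs_ballP[e /= e0 eO] : nbhs x Om.
  by apply: open_nbhs_nbhs; split => //; exact: dom_open.
apply: (lt_le_trans e0); apply: bdist_ge => z Oz; rewrite leNgt; apply/negP => xz.
apply: Oz; apply: eO; split => // i j; rewrite ord1 /ball/=.
by have := coord_le_enorm (x - z) j; rewrite !mxE => /le_lt_trans; exact.
Qed.

Lemma bdist_out x : ~ dom Om x -> bdist Om x = 0.
Proof.
move=> Ox; apply/eqP; rewrite eq_le bdist_ge0 andbT.
apply: le_trans (bdist_le x Ox) _.
by rewrite subrr /enorm big1 ?sqrtr0// => i _; rewrite mxE expr0n.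
Qed.

Lemma continuous_bdist : continuous (bdist Om).
Proof. by apply: enorm_lipschitz_continuous; exact: bdist_lipschitz. Qed.

(** One constant serves for the diameter and for the distance to the complement; [1 <= D] makes the
    powers of [D] monotone in the exponent. *)
Lemma dom_diameter : exists2 D : R, 1 <= D &
  (forall x, dom Om x -> bdist Om x <= D) /\
  (forall x y, dom Om x -> dom Om y -> enorm (x - y) <= D).
Proof.
have [M M0 OM] := dom_coord_bounded; have [z Oz] := dom_complement_neq0.
have nM (x y : 'rV[R]_n) : dom Om x -> dom Om y -> enorm (x - y) <= n%:R * (M + M).
  move=> Ox Oy; apply: enorm_le => i; rewrite !mxE.
  by apply: le_trans (ler_normB _ _) _; rewrite lerD// OM.
have [x0 Ox0] := dom_neq0 Om.
exists (1 + n%:R * (M + M) + enorm (x0 - z)).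
  by rewrite -addrA lerDl addr_ge0 ?mulr_ge0 ?addr_ge0 ?enorm_ge0// ltW.
split=> [x Ox|x y Ox Oy].
  apply: le_trans (bdist_le x Oz) _; apply: le_trans (enorm_triangle x0 _ _) _.
  by rewrite lerD2r; apply: le_trans (nM _ _ Ox Ox0) _; rewrite lerDr.
by apply: le_trans (nM _ _ Ox Oy) _; rewrite addrAC lerDr addr_ge0 ?enorm_ge0.
Qed.

Section bdist_power.
Variable gam : R.
Hypothesis gam0 : 0 < gam.

Lemma bdist_pow_ge0 x : 0 <= bdist_pow Om gam x.
Proof. exact: powR_ge0. Qed.

Lemma bdist_pow_gt0 x : dom Om x -> 0 < bdist_pow Om gam x.
Proof. by move=> Ox; rewrite powR_gt0// bdist_gt0. Qed.

Lemma bdist_pow_out x : ~ dom Om x -> bdist_pow Om gam x = 0.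
Proof. by move=> Ox; rewrite /bdist_pow bdist_out// powR0// gt_eqF. Qed.

Lemma measurable_bdist : measurable_fun setT (bdist Om).
Proof. by apply: continuous_measurable_fun_rV; exact: continuous_bdist. Qed.

Lemma measurable_bdist_pow (a : R) : measurable_fun setT (fun x => bdist Om x `^ a).
Proof. exact: (measurableT_comp (measurable_powR a) measurable_bdist). Qed.

Lemma continuous_bdist_pow x : dom Om x -> {for x, continuous (bdist_pow Om gam)}.
Proof.
move=> Ox.
apply: (@continuous_comp _ _ _ (bdist Om) (@powR R ^~ gam)).
  exact: continuous_bdist.
apply: differentiable_continuous; apply/derivable1_diffP.
by apply: derivable_powR; rewrite in_itv/= andbT bdist_gt0.
Qed.

End bdist_power.
End boundary_distance.

(** * Pointwise inequalities between powers of distances *)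

Section power_inequalities.
Context {R : realType}.
Implicit Types x y r p : R.

Lemma le0_ler_powR p x y : p <= 0 -> 0 < x -> x <= y -> y `^ p <= x `^ p.
Proof.
move=> p0 x0 xy; have y0 := lt_le_trans x0 xy.
by rewrite /powR !gt_eqF// ler_expR ler_wnM2l// ler_ln.
Qed.

Lemma powR_le_2 p : p <= 1 -> (2 : R) `^ p <= 2.
Proof. by move=> p1; rewrite -[leRHS]powRr1// ler_powR// ler1n. Qed.

Lemma powRD_gt0 x p q : 0 < x -> x `^ (p + q) = x `^ p * x `^ q.
Proof. by move=> x0; rewrite powRD// (gt_eqF x0) implybT. Qed.

(* With [r = |x - y|], [dx = dist(x, Om^c)], [dy = dist(y, Om^c)]. For
   [dx < r] one has [dx dy / r^2 <= 2 dx / r], which is traded for [dx ^ (a + c)]. *)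
Lemma profile_weight_aux (dx dy r gam a c : R) :
  0 < dx -> 0 < dy -> 0 < r -> dy <= dx + r ->
  0 <= a -> 0 <= c -> a + c <= gam -> gam <= 1 ->
  Num.min (dx * dy / r ^+ 2) 1 `^ gam * dy `^ a * r `^ c <= 4 * dx `^ (a + c).
Proof.
move=> dx0 dy0 r0 dyxr a0 c0 acg g1.
set m := Num.min _ _.
have m0 : 0 < m by rewrite lt_min ltr01 andbT divr_gt0 ?mulr_gt0 ?exprn_gt0.
have m1 : m <= 1 by rewrite ge_min lexx orbT.
have [rdx|dxr] := leP r dx.
  have mg1 : m `^ gam <= 1.
    by rewrite -(powRr0 m) ger_powR ?m0//; lra.
  have dya : dy `^ a <= 2 * dx `^ a.
    apply: (@le_trans _ _ ((2 * dx) `^ a)).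
      by apply: ge0_ler_powR => //; rewrite ?nnegrE; lra.
    by rewrite powRM ?ler_wpM2r ?powR_ge0 ?powR_le_2//; lra.
  have rc : r `^ c <= dx `^ c by apply: ge0_ler_powR; rewrite ?nnegrE// ltW.
  rewrite powRD_gt0//.
  apply: (@le_trans _ _ ((1 * (2 * dx `^ a)) * dx `^ c)).
    by rewrite ler_pM ?mulr_ge0 ?powR_ge0// ler_pM ?powR_ge0.
  by rewrite mul1r -mulrA ler_wpM2r ?mulr_ge0 ?powR_ge0// ler_nat.
have mq : m <= 2 * dx / r.
  rewrite ge_min; apply/orP; left.
  rewrite expr2 invfM mulrA ler_pM2r ?invr_gt0// ler_pdivrMr//.
  by rewrite -mulrA mulrCA ler_pM2l//; lra.
have mg : m `^ gam <= 2 * dx `^ (a + c) * r `^ (- (a + c)).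
  apply: (@le_trans _ _ ((2 * dx / r) `^ (a + c))).
    apply: (@le_trans _ _ (m `^ (a + c))); first by rewrite ger_powR ?m0.
    apply: ge0_ler_powR; rewrite ?nnegrE//; [lra|exact: ltW|].
    by rewrite divr_ge0 ?mulr_ge0// ltW.
  rewrite powRM ?invr_ge0 ?(ltW r0) ?mulr_ge0 ?(ltW dx0)//.
  rewrite powRM ?(ltW dx0)// -[r^-1]powR_inv1 ?(ltW r0)// -powRrM mulN1r.
  by rewrite !ler_wpM2r ?powR_ge0// powR_le_2//; lra.
have dya : dy `^ a <= 2 * r `^ a.
  apply: (@le_trans _ _ ((2 * r) `^ a)).
    by apply: ge0_ler_powR => //; rewrite ?nnegrE; lra.
  by rewrite powRM ?ler_wpM2r ?powR_ge0 ?powR_le_2//; lra.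
apply: (@le_trans _ _ ((2 * dx `^ (a + c) * r `^ (- (a + c))) * (2 * r `^ a) * r `^ c)).
  by rewrite ler_wpM2r ?powR_ge0// ler_pM ?powR_ge0.
have e : r `^ (- (a + c)) * r `^ a * r `^ c = 1.
  by rewrite -!powRD_gt0// -addrA addNr powRr0.
rewrite [leLHS](_ : _ =
  4 * dx `^ (a + c) * (r `^ (- (a + c)) * r `^ a * r `^ c)); last by ring.
by rewrite e mulr1.
Qed.

(** The singularity r^(-(N - 2s)) is written as r^(-(N - s)) r^(s - c) r^c. The factor r^c is
    converted into the weight gain by [profile_weight_aux], r^(s - c) is bounded by D^s, and a
    kernel of order [s] survives. *)
Lemma profile_weight (D N s gam a c dx dy r : R) :
  1 <= D -> 0 < dx -> 0 < dy -> 0 < r -> r <= D -> dy <= dx + r ->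
  0 <= a -> 0 <= c -> c <= s -> a + c <= gam -> gam <= 1 ->
  r `^ (- (N - 2 * s)) * Num.min (dx * dy / r ^+ 2) 1 `^ gam * dy `^ a <=
  4 * D `^ s * (dx `^ (a + c) * r `^ (- (N - s))).
Proof.
move=> D1 dx0 dy0 r0 rD dyxr a0 c0 cs acg g1.
have h := profile_weight_aux dx0 dy0 r0 dyxr a0 c0 acg g1.
set m := Num.min _ _ `^ gam in h *.
have -> : r `^ (- (N - 2 * s)) = r `^ (- (N - s)) * r `^ (s - c) * r `^ c.
  by rewrite -!powRD_gt0//; congr (_ `^ _); ring.
have rs : r `^ (s - c) <= D `^ s.
  apply: (@le_trans _ _ (D `^ (s - c))).
    by apply: ge0_ler_powR; rewrite ?nnegrE; lra.
  by rewrite ler_powR//; lra.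
rewrite [leLHS](_ : _ = r `^ (- (N - s)) * (r `^ (s - c) * (m * dy `^ a * r `^ c))); last by ring.
rewrite [leRHS](_ : _ = r `^ (- (N - s)) * (D `^ s * (4 * dx `^ (a + c)))); last by ring.
by rewrite ler_wpM2l ?powR_ge0// ler_pM ?mulr_ge0 ?powR_ge0.
Qed.

(* The factor [r ^ th] is absorbed by the larger of [u] and [v], after which
   the exponents are collected on the smaller one. *)
Lemma riesz_composition (D A e b r u v : R) (th := Num.max 0 (b - e)) :
  1 <= D -> 0 < r -> 0 < u -> 0 < v -> u <= D -> v <= D -> r <= u + v ->
  0 < e -> 0 <= b -> b <= A ->
  u `^ (- A) * v `^ (- b) <=
  2 `^ A * D `^ e * r `^ (- th) * (u `^ (- (A + e)) + v `^ (- (A + e))).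
Proof.
move=> D1 r0 u0 v0 uD vD ruv e0 b0 bA.
have th0 : 0 <= th by rewrite le_max lexx.
have thb : th <= b by rewrite ge_max b0 gerBl ltW.
have the : b - e <= th by rewrite le_max lexx orbT.
(* [th] is the least nonnegative exponent with [th - b + e >= 0]. The surplus power of [w] then has
   an exponent between [0] and [e], and D^e bounds it. *)
have key (w : R) : 0 < w -> w <= D -> w `^ (th - A - b) <= D `^ e * w `^ (- (A + e)).
  move=> w0 wD.
  have -> : th - A - b = (th - b + e) + - (A + e) by ring.
  rewrite powRD_gt0// ler_wpM2r ?powR_ge0//.
  apply: (@le_trans _ _ (D `^ (th - b + e))).
    by apply: ge0_ler_powR; rewrite ?nnegrE; lra.
  by rewrite ler_powR//; lra.
suff h : r `^ th * (u `^ (- A) * v `^ (- b)) <=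
    2 `^ A * D `^ e * (u `^ (- (A + e)) + v `^ (- (A + e))).
  rewrite -(ler_pM2l (powR_gt0 th r0)); apply: (le_trans h).
  rewrite [leRHS](_ : _ = (r `^ th * r `^ (- th)) *
    (2 `^ A * D `^ e * (u `^ (- (A + e)) + v `^ (- (A + e))))); last by ring.
  by rewrite -powRD_gt0// subrr powRr0 mul1r.
have rth (w : R) : 0 < w -> r <= 2 * w -> r `^ th <= 2 `^ A * w `^ th.
  move=> w0 rw; apply: (@le_trans _ _ ((2 * w) `^ th)).
    by apply: ge0_ler_powR; rewrite ?nnegrE; lra.
  rewrite powRM ?ler_wpM2r ?powR_ge0//; last lra.
  by rewrite ler_powR ?ler1n//; lra.
have [uv|/ltW vu] := leP u v.
  apply: (@le_trans _ _ ((2 `^ A * v `^ th) * (u `^ (- A) * v `^ (- b)))).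
    by rewrite ler_wpM2r ?mulr_ge0 ?powR_ge0// rth//; lra.
  rewrite -!mulrA; rewrite ler_wpM2l ?powR_ge0//.
  apply: (@le_trans _ _ (D `^ e * u `^ (- (A + e)))); last first.
    by rewrite ler_wpM2l ?powR_ge0// lerDl powR_ge0.
  apply: le_trans (key _ u0 uD).
  rewrite mulrCA -powRD_gt0// mulrC (_ : th - A - b = th - b + - A); last by ring.
  rewrite [leRHS]powRD_gt0// ler_wpM2r ?powR_ge0//.
  by apply: le0_ler_powR => //; lra.
apply: (@le_trans _ _ ((2 `^ A * u `^ th) * (u `^ (- A) * v `^ (- b)))).
  by rewrite ler_wpM2r ?mulr_ge0 ?powR_ge0// rth//; lra.
rewrite -!mulrA; rewrite ler_wpM2l ?powR_ge0//.
apply: (@le_trans _ _ (D `^ e * v `^ (- (A + e)))); last first.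
  by rewrite ler_wpM2l ?powR_ge0// lerDr powR_ge0.
apply: le_trans (key _ v0 vD).
rewrite mulrA -powRD_gt0// [leRHS]powRD_gt0// ler_wpM2r ?powR_ge0//.
by apply: le0_ler_powR => //; lra.
Qed.

Lemma geometric_sum_le (q : R) N : 0 <= q -> q < 1 ->
  \sum_(k < N) q ^+ k <= (1 - q)^-1.
Proof.
move=> q0 q1; have h : (1 - q) * \sum_(k < N) q ^+ k = 1 - q ^+ N.
  elim: N => [|N ih]; first by rewrite big_ord0 expr0 mulr0 subrr.
  rewrite big_ord_recr/= mulrDr ih exprS; ring.
rewrite -[leRHS]mul1r ler_pdivlMr ?subr_gt0// mulrC h gerBl exprn_ge0//.
Qed.

End power_inequalities.

(** * Lebesgue measure of cubes, points and open sets *)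

Section lebesgue_measure_rV.
Context {R : realType} {n : nat}.
Local Notation E := 'rV[R]_n.
Local Notation lambda := (@lebesgue_rV R n).
Hypothesis n0 : (0 < n)%N.
Implicit Types x y z : E.

Definition cube x (r : R) : set E := [set z | forall i, ball (x 0 i) r (z 0 i)].

Lemma lebesgue_rV_cube x (r : R) : 0 <= r -> lambda (cube x r) = ((2 * r) ^+ n)%:E.
Proof.
move=> r0.
rewrite (@lebesgue_rV_box R n (fun i => ball (x 0 i) r)); last first.
  by move=> i; exact: measurable_ball.
rewrite (eq_bigr (fun=> (2 * r)%:E)); last first.
  by move=> i _; rewrite lebesgue_measure_ball// -[r *+ 2]mulr_natl.
elim: {+}n => [|m ih]; first by rewrite big_ord0.
by rewrite big_ord_recl ih exprS EFinM.
Qed.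

Lemma measurable_box (A : 'I_n -> set R) : (forall i, measurable (A i)) ->
  measurable [set z : E | forall i, A i (z 0 i)].
Proof.
move=> mA.
have -> : [set z : E | forall i, A i (z 0 i)] =
    \bigcap_(i in [set: 'I_n]) (fun z : E => z 0 i) @^-1` A i.
  by apply/seteqP; split => [z Az i _|z Az i]; [exact: Az|exact: (Az i)].
apply: fin_bigcap_measurable => // i _.
rewrite -[X in measurable X]setTI.
by apply: (continuous_measurable_fun_rV (@coord_continuous _ _ _ 0 i)).
Qed.

Lemma measurable_cube x (r : R) : measurable (cube x r).
Proof. by apply: (@measurable_box (fun i => ball (x 0 i) r)) => i; exact: measurable_ball. Qed.

Lemma rV_set1E x : [set x] = [set z : E | forall i, [set x 0 i] (z 0 i)].
Proof.
apply/seteqP; split => [z ->//|z /= xz].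
by apply/rowP => i; rewrite xz.
Qed.

Lemma measurable_rV_set1 x : measurable [set x].
Proof. by rewrite rV_set1E; apply: (@measurable_box (fun i => [set x 0 i])). Qed.

Lemma cube_sub_nbhs x (A : set E) : nbhs x A -> exists2 r : R, 0 < r & cube x r `<=` A.
Proof.
move=> /nbhs_ballP[e /= e0 eA]; exists e => // z xz; apply: eA.
by split => // i j; rewrite ord1; exact: xz.
Qed.

Lemma lebesgue_rV_point x : lambda [set x] = 0%E.
Proof.
rewrite rV_set1E (@lebesgue_rV_box R n (fun i => [set x 0 i]))//.
by rewrite (bigD1 (Ordinal n0))//= lebesgue_measure_set1 mul0e.
Qed.

Lemma lebesgue_rV_open_gt0 (A : set E) : open A -> A !=set0 -> (0 < lambda A)%E.
Proof.
move=> oA [x Ax]; have [r r0 rA] := cube_sub_nbhs (open_nbhs_nbhs (conj oA Ax)).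
apply: (@lt_le_trans _ _ (lambda (cube x r))).
  by rewrite lebesgue_rV_cube ?(ltW r0)// lte_fin exprn_gt0// mulr_gt0.
apply: le_measure => //; rewrite inE; first exact: measurable_cube.
exact: open_measurable_rV.
Qed.

End lebesgue_measure_rV.

(** * Lebesgue measure on the domain and integrability of Riesz kernels *)

Section lebesgue_measure_domain.
Context {R : realType} {n : nat}.
Local Notation E := 'rV[R]_n.
Local Notation lambda := (@lebesgue_rV R n).
Variable Om : bounded_domain R n.
Local Notation mu := (leb Om).
Hypothesis n0 : (0 < n)%N.
Implicit Types x y z : E.

Lemma measurable_dom : measurable (dom Om).
Proof. by apply: open_measurable_rV; exact: dom_open. Qed.

Lemma leb_lebesgue (A : set E) : A `<=` Om -> mu A = lambda A.
Proof. by move=> AO; rewrite /leb/= /mrestr setIidl. Qed.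

Lemma leb_lty : (mu setT < +oo)%E.
Proof.
have [M M0 OM] := dom_coord_bounded Om.
rewrite /leb/= /mrestr setTI.
have M1 : 0 < M + 1 by rewrite addr_gt0.
apply: (@le_lt_trans _ _ (lambda (cube 0 (M + 1)))).
  apply: le_measure; rewrite ?inE; [exact: measurable_dom|exact: measurable_cube|].
  move=> x Ox i; rewrite mxE /ball/= sub0r normrN.
  by apply: le_lt_trans (OM x Ox i) _; rewrite ltrDl.
by rewrite lebesgue_rV_cube ?ltry// ltW.
Qed.

Lemma ae_dom : \forall x \ae mu, dom Om x.
Proof.
exists (~` (dom Om)); split => //; first by apply: measurableC; exact: measurable_dom.
by rewrite /leb/= /mrestr setICl measure0.
Qed.

Lemma ae_neq x : \forall z \ae mu, z != x.
Proof.
have mx := measurable_rV_set1 x.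
exists [set x]; split => //; last by move=> z /= /negP/negPn/eqP.
apply/eqP; rewrite eq_le measure_ge0 andbT -(lebesgue_rV_point n0 x).
rewrite /leb/= /mrestr; apply: le_measure; rewrite ?inE//.
by apply: measurableI => //; exact: measurable_dom.
Qed.

(** Nonempty open sets have positive measure, so an exceptional null set contains no neighbourhood.
    This is what carries statements holding almost everywhere over to every point, for continuous
    functions. *)
Lemma ae_open_dense (A : set E) x : (\forall z \ae mu, A z) -> dom Om x ->
  forall U, nbhs x U -> exists z, [/\ dom Om z, A z & U z].
Proof.
move=> [N [mN N0 AN]] Ox U xU; apply: contrapT => h.
have : nbhs x (dom Om `&` U).
  by apply: filterI => //; apply: open_nbhs_nbhs; split => //; exact: dom_open.
rewrite nbhsE => -[V [oV Vx] VOU].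
have : (0 < lambda V)%E by apply: lebesgue_rV_open_gt0 => //; exists x.
rewrite -leb_lebesgue; last by move=> z /VOU[].
rewrite lt0e => /andP[/negP + _]; apply; apply/eqP.
apply/eqP; rewrite eq_le measure_ge0 andbT -N0.
apply: le_measure; rewrite ?inE//; first exact: open_measurable_rV.
move=> z Vz; apply: AN => /= Az; apply: h; exists z.
by have [Oz Uz] := VOU z Vz; split.
Qed.

Lemma ae_eq_continuous_dom (f g : E -> R) :
  {within dom Om, continuous f} -> {within dom Om, continuous g} ->
  f = g %[ae mu] -> forall x, dom Om x -> f x = g x.
Proof.
move=> cf cg fg x Ox.
have := cf; rewrite (continuous_open_subspace _ (@dom_open _ _ Om)) => /(_ x (mem_set Ox)) fx.
have := cg; rewrite (continuous_open_subspace _ (@dom_open _ _ Om)) => /(_ x (mem_set Ox)) gx.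
apply: contrapT => /eqP fgx.
have e0 : 0 < `|f x - g x| / 2 by rewrite divr_gt0// normr_gt0 subr_eq0.
move: fx => /(iffLR (@cvgrPdist_lt R R^o _ (nbhs x) (nbhs_filter x) f (f x))) /(_ _ e0) fx.
move: gx => /(iffLR (@cvgrPdist_lt R R^o _ (nbhs x) (nbhs_filter x) g (g x))) /(_ _ e0) gx.
have [z [Oz fgz []]] := ae_open_dense fg Ox (filterI fx gx).
rewrite fgz// => h1 h2.
have : `|f x - g x| < `|f x - g x|.
  rewrite [ltRHS]splitr.
  by apply: le_lt_trans (ler_distD (g z) _ _) _; rewrite ltrD// distrC.
by rewrite ltxx.
Qed.

Lemma integral_leb_dom (f : E -> \bar R) : measurable_fun setT f ->
  (\int[mu]_x f x = \int[lambda]_(x in dom Om) f x)%E.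
Proof.
move=> mf; have mO := measurable_dom.
transitivity (\int[mu]_(x in dom Om) f x)%E; last first.
  by apply: eq_measure_integral => A mA AO; exact: leb_lebesgue.
rewrite [RHS]integral_mkcond; apply: ae_eq_integral => //.
  by apply/(measurable_restrictT f mO); exact: measurable_funTS.
by apply: filterS ae_dom => x Ox _; rewrite patchE mem_set.
Qed.

(** Dyadic decomposition around [x]: where |x - z| lies between [h k.+1] and [h k] the kernel is at
    most [c k], and this shell lies in a cube of volume proportional to (h k)^n. The products form a
    geometric series of ratio 2^(p - n) < 1. *)
Lemma riesz_potential_bounded (p : R) : 0 < p -> p < n%:R ->
  exists2 C : R, 0 < C & forall x, dom Om x ->
    (\int[mu]_z (enorm (x - z) `^ (- p))%:E <= C%:E)%E.
Proof.
move=> p0 pn.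
have [D D1 [_ OD]] := dom_diameter Om n0.
have D0 : 0 < D by rewrite (lt_le_trans ltr01).
pose q : R := 2 `^ (p - n%:R).
have q0 : 0 < q by rewrite powR_gt0.
have q1 : q < 1.
  by rewrite -(powRr0 2) /q /powR !gt_eqF// ltr_expR ltr_pM2r ?ln_gt0 ?ltr1n// subr_lt0.
pose h k : R := D / 2 ^+ k.
have h0 k : 0 < h k by rewrite divr_gt0// exprn_gt0.
pose c k : R := h k.+1 `^ (- p).
pose C : R := D `^ (- p) * 2 `^ p * (4 * D) ^+ n.
have C0 : 0 < C by rewrite !mulr_gt0 ?powR_gt0 ?exprn_gt0 ?mulr_gt0.
have cE k : c k * (2 * (2 * h k)) ^+ n = C * q ^+ k.
  have cE : c k = D `^ (- p) * (2 `^ p) ^+ k.+1.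
    rewrite /c /h powRM ?invr_ge0 ?exprn_ge0 ?(ltW D0)//; congr (_ * _).
    by rewrite -powR_invn// -powRrM mulrNN mulrC powRrM powR_mulrn// powR_ge0.
  have hE : (2 * (2 * h k)) ^+ n = (4 * D) ^+ n * ((2 ^+ n) ^+ k)^-1.
    rewrite /h (_ : 2 * (2 * (D / 2 ^+ k)) = (4 * D) * (2 ^+ k)^-1); last by ring.
    by rewrite exprMn exprVn exprAC.
  have qE : q ^+ k = (2 `^ p) ^+ k * ((2 ^+ n) ^+ k)^-1.
    by rewrite /q powRD_gt0// powR_invn// exprMn exprVn.
  by rewrite cE hE qE exprS /C; ring.
exists (C / (1 - q)) => [|x Ox]; first by rewrite divr_gt0// subr_gt0.
(* The radius is doubled because the cube is open whereas the shell includes its outer radius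
   [h k]. *)
pose B k := cube x (2 * h k).
have mB k : measurable (B k) by exact: measurable_cube.
have mf k : measurable_fun setT (fun z => (c k * \1_(B k) z)%:E).
  apply/measurable_EFinP; apply: measurable_funM => //; exact: measurable_indic.
have f0 k z : (0 <= (c k * \1_(B k) z)%:E)%E.
  by rewrite lee_fin mulr_ge0 ?powR_ge0.
apply: (@le_trans _ _ (\int[mu]_z (\sum_(0 <= k <oo) (c k * \1_(B k) z)%:E))%E).
  apply: ae_ge0_le_integral => //.
  - by move=> z _; rewrite lee_fin powR_ge0.
  - apply/measurable_EFinP; apply: (measurableT_comp (measurable_powR _)).
    by apply: continuous_measurable_fun_rV => z; rewrite (_ : (fun z => enorm (x - z)) = fun z => enorm (z - x)); [exact: continuous_enormB|apply/funext => w; rewrite enormB].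
  - by move=> z _; apply: nneseries_ge0 => k _ _.
  - by apply: ge0_emeasurable_sum => // k z _ _.
  apply: filterS ae_dom => z Oz _.
  (* At [z = x] the convention 0^(-p) = 0 makes the bound trivial. *)
  have [r0|r0] := eqVneq (enorm (x - z)) 0.
    by rewrite r0 powR0 ?oppr_eq0 ?gt_eqF//; apply: nneseries_ge0 => k _ _.
  have rp : 0 < enorm (x - z) by rewrite lt_neqAle eq_sym r0 enorm_ge0.
  have hex : exists k, h k.+1 < enorm (x - z).
    exists (Num.bound (D / enorm (x - z))).
    rewrite /h ltr_pdivrMr ?exprn_gt0// mulrC -ltr_pdivrMr//.
    have := archi_boundP (divr_ge0 (ltW D0) (ltW rp)) => /lt_le_trans; apply.
    rewrite -natrX ler_nat ltnW// (ltn_trans (ltn_expl _ (ltnSn 1)))//.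
    by rewrite ltn_exp2l.
  (* The least such [k] is the index of the shell of [z]: minimality gives |x - z| <= h k, and for
     [k = 0] the diameter bound does. *)
  case: (ex_minnP hex) => k hk kmin.
  have rk : enorm (x - z) <= h k.
    case: k {hk} kmin => [_|k kmin]; first by rewrite /h expr0 divr1 OD.
    by rewrite leNgt; apply/negP => /kmin; rewrite ltnn.
  have Bz : B k z.
    move=> i; apply: (@le_lt_trans _ _ (h k)); last by rewrite mulr_natl mulr2n ltrDl.
    by apply: le_trans rk; have := coord_le_enorm (x - z) i; rewrite !mxE.
  apply: (@le_trans _ _ (\sum_(0 <= i < k.+1) (c i * \1_(B i) z)%:E)%E); last first.
    by apply: nneseries_lim_ge => i _ _.
  rewrite big_nat_recr//= indicE mem_set// mulr1.
  apply: (@le_trans _ _ (c k)%:E).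
    by rewrite lee_fin; apply: le0_ler_powR => //; [rewrite oppr_le0 ltW|exact: ltW].
  by rewrite leeDr// sume_ge0.
rewrite integral_nneseries//.
apply: lime_le; first by apply: is_cvg_nneseries => k _ _; exact: integral_ge0.
apply: nearW => N.
apply: (@le_trans _ _ (\sum_(0 <= k < N) (C * q ^+ k)%:E)%E).
  apply: lee_sum => k _.
  under eq_integral do rewrite EFinM.
  rewrite ge0_integralZl_EFin ?powR_ge0//; last first.
    by apply/measurable_EFinP; exact: measurable_indic.
  rewrite integral_indic// setIT -cE EFinM lee_wpmul2l ?lee_fin ?powR_ge0//.
  have h2 : 0 <= 2 * h k by rewrite mulr_ge0// ltW.
  rewrite -(lebesgue_rV_cube x h2) /leb/= /mrestr.
  apply: le_measure; rewrite ?inE//.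
    by apply: measurableI => //; exact: measurable_dom.
  exact: measurable_cube.
rewrite sumEFin lee_fin big_mkord -mulr_sumr ler_wpM2l ?(ltW C0)//.
by apply: geometric_sum_le => //; exact: ltW.
Qed.

End lebesgue_measure_domain.

(** * Tonelli's theorem for the measure on the domain *)

Section leb_tonelli.
Context {R : realType} {n : nat}.
Local Notation E := 'rV[R]_n.
Variable Om : bounded_domain R n.
Local Notation mu := (leb Om).

Let Om_lty : (@lebesgue_rV R n (dom Om) < +oo)%E.
Proof. 
rewrite -(@leb_lebesgue _ _ Om)//; apply: le_lt_trans (leb_lty Om).
by apply: le_measure; rewrite ?inE//; exact: measurable_dom.
 Qed.

(** [leb] is typed as a mere measure. This is the same set function with its finiteness recorded,
    which supplies the sigma-finiteness required by Tonelli's theorem. *)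
Let nu : {finite_measure set E -> \bar R} :=
  mfrestr (open_measurable_rV (@dom_open _ _ Om)) Om_lty.

Let integral_nu (f : E -> \bar R) : (\int[mu]_x f x = \int[nu]_x f x)%E.
Proof. exact: eq_measure_integral. Qed.

Lemma leb_tonelli (f : E * E -> \bar R) : measurable_fun setT f ->
  (forall p, (0 <= f p)%E) ->
  (\int[mu]_x \int[mu]_y f (x, y) = \int[mu]_y \int[mu]_x f (x, y))%E.
Proof.
move=> mf f0; rewrite !integral_nu.
under eq_integral do rewrite integral_nu.
under [RHS]eq_integral do rewrite integral_nu.
exact: fubini_tonelli.
Qed.

Lemma measurable_leb_section (f : E * E -> \bar R) : measurable_fun setT f ->
  (forall p, (0 <= f p)%E) -> measurable_fun setT (fun x => \int[mu]_y f (x, y))%E.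
Proof.
move=> mf f0; rewrite (_ : (fun x => _) = fun x => (\int[nu]_y f (x, y))%E).
  exact: measurable_fun_fubini_tonelli_F.
by apply/funext => x; exact: integral_nu.
Qed.
End leb_tonelli.

(** * Composition of Riesz potentials *)

Section riesz_iteration.
Context {R : realType} {n : nat}.
Local Notation E := 'rV[R]_n.
Variable Om : bounded_domain R n.
Local Notation mu := (leb Om).
Hypothesis n0 : (0 < n)%N.

Definition riesz_potential (b : R) (g : E -> R) (x : E) : \bar R :=
  (\int[mu]_y (enorm (x - y) `^ (- b) * g y)%:E)%E.

Lemma measurable_riesz_kernel (b : R) (x : E) :
  measurable_fun setT (fun y : E => enorm (x - y) `^ (- b)).
Proof.
apply: (measurableT_comp (measurable_powR _)).
apply: continuous_measurable_fun_rV => z.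
rewrite (_ : (fun z => enorm (x - z)) = fun z => enorm (z - x)).
  exact: continuous_enormB.
by apply/funext => w; rewrite enormB.
Qed.

Lemma measurable_riesz_potential (b : R) (g : E -> R) :
  measurable_fun setT g -> (forall y, 0 <= g y) ->
  measurable_fun setT (riesz_potential b g).
Proof.
move=> mg g0.
apply: (@measurable_leb_section _ _ Om (fun p : E * E => (enorm (p.1 - p.2) `^ (- b) * g p.2)%:E)).
  apply/measurable_EFinP; apply: measurable_funM.
    exact: (measurableT_comp (measurable_powR _) measurable_enormB).
  exact: (measurableT_comp mg measurable_snd).
by move=> p; rewrite lee_fin mulr_ge0 ?powR_ge0.
Qed.

Lemma riesz_potential_ge0 b g x : (forall y, 0 <= g y) ->
  (0 <= riesz_potential b g x)%E.
Proof. by move=> g0; apply: integral_ge0 => y _; rewrite lee_fin mulr_ge0 ?powR_ge0. Qed.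

(** After exchanging the integrals, [riesz_composition] with [A = n - s] and [e = s / 2] extracts
    the new kernel and leaves two kernels in [z] of exponent [p = n - s / 2 < n], whose integrals
    are bounded uniformly in the centre. *)
Lemma riesz_potential_iter (s b : R) : 0 < s -> s < n%:R -> 0 <= b -> b <= n%:R - s ->
  exists2 K : R, 0 < K & forall g : E -> R, measurable_fun setT g ->
    (forall y, 0 <= g y) -> forall x, dom Om x ->
    (\int[mu]_z ((enorm (x - z) `^ (- (n%:R - s)))%:E * riesz_potential b g z) <=
     K%:E * riesz_potential (Num.max 0 (b - s / 2))%R g x)%E.
Proof.
move=> s0 sn b0 bn.
have [D D1 [_ OD]] := dom_diameter Om n0.
have D0 : 0 < D by rewrite (lt_le_trans ltr01).
pose p : R := n%:R - s + s / 2.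
have [C C0 HC] : exists2 C : R, 0 < C & forall x, dom Om x ->
    (\int[mu]_z (enorm (x - z) `^ (- p))%:E <= C%:E)%E.
  by apply: riesz_potential_bounded => //; rewrite /p; lra.
pose K : R := 2 `^ (n%:R - s) * D `^ (s / 2).
have K0 : 0 < K by rewrite mulr_gt0 ?powR_gt0.
exists (K * (C + C)) => [|g mg g0 x Ox]; first by rewrite mulr_gt0 ?addr_gt0.
pose F (q : E * E) : \bar R := (enorm (x - q.1) `^ (- (n%:R - s)) *
  (enorm (q.1 - q.2) `^ (- b) * g q.2))%:E.
have mF : measurable_fun setT F.
  apply/measurable_EFinP; apply: measurable_funM.
    exact: (measurableT_comp (measurable_riesz_kernel _ x) measurable_fst).
  apply: measurable_funM.
    exact: (measurableT_comp (measurable_powR _) measurable_enormB).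
  exact: (measurableT_comp mg measurable_snd).
have F0 q : (0 <= F q)%E by rewrite lee_fin !mulr_ge0 ?powR_ge0.
rewrite [leLHS](_ : _ = \int[mu]_z \int[mu]_y F (z, y))%E; last first.
  apply: eq_integral => z _; rewrite /riesz_potential -ge0_integralZl_EFin ?powR_ge0//.
    by move=> y _; rewrite lee_fin mulr_ge0 ?powR_ge0.
  apply/measurable_EFinP; apply: measurable_funM => //.
  exact: measurable_riesz_kernel.
rewrite leb_tonelli//.
set th := Num.max _ _.
have mr : measurable_fun setT (fun y : E => (enorm (x - y) `^ (- th) * g y)%:E).
  apply/measurable_EFinP; apply: measurable_funM => //.
  exact: measurable_riesz_kernel.
have r0 y : (0 <= (enorm (x - y) `^ (- th) * g y)%:E)%E.
  by rewrite lee_fin mulr_ge0 ?powR_ge0.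
rewrite /riesz_potential -ge0_integralZl_EFin//; last first.
  by rewrite mulr_ge0 ?addr_ge0// ltW.
apply: ae_ge0_le_integral => //.
- by move=> y _; apply: integral_ge0.
- have mF' : measurable_fun setT (fun q : E * E => F (q.2, q.1)).
    exact: (measurableT_comp mF (@measurable_swap _ _ E E)).
  by apply: (@measurable_leb_section _ _ Om _ mF') => q; exact: F0.
- by move=> y _; rewrite mule_ge0// lee_fin mulr_ge0 ?addr_ge0// ltW.
- by apply: measurable_funeM.
(* The composition inequality needs three positive distances; the coincidences [y = x], [z = x] and
   [z = y] are null sets. *)
apply: filterS2 (ae_dom Om) (ae_neq Om n0 x) => y Oy yx _.
have rp : 0 < enorm (x - y) by rewrite enorm_gt0// subr_eq0 eq_sym.
pose A := K * (enorm (x - y) `^ (- th) * g y).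
have A0 : 0 <= A by rewrite !mulr_ge0 ?powR_ge0// ltW.
apply: (@le_trans _ _ (\int[mu]_z (A%:E * ((enorm (x - z) `^ (- p))%:E + (enorm (y - z) `^ (- p))%:E)))%E).
  apply: ae_ge0_le_integral => //.
  - exact: (measurableT_comp mF (measurable_pair2 y)).
  - by move=> z _; rewrite -EFinD -EFinM lee_fin mulr_ge0 ?addr_ge0 ?powR_ge0.
  - apply: measurable_funeM; apply: emeasurable_funD;
      apply/measurable_EFinP; exact: measurable_riesz_kernel.
  apply: filterS3 (ae_dom Om) (ae_neq Om n0 x) (ae_neq Om n0 y) => z Oz zx zy _.
  rewrite /F/= -EFinD -EFinM lee_fin.
  have := @riesz_composition R D (n%:R - s) (s / 2) b (enorm (x - y)) (enorm (x - z)) (enorm (z - y)).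
  move=> /(_ D1 rp); rewrite [enorm (z - y)]enormB.
  rewrite !enorm_gt0 ?subr_eq0; last 2 first.
  - by rewrite eq_sym.
  - by rewrite eq_sym.
  move=> /(_ isT isT (OD _ _ Ox Oz) (OD _ _ Oy Oz)).
  have tri : enorm (x - y) <= enorm (x - z) + enorm (y - z).
    by rewrite (enormB y z); exact: enorm_triangle.
  have s20 : 0 < s / 2 by lra.
  move=> /(_ tri s20 b0 bn) h.
  rewrite mulrA; apply: le_trans (ler_wpM2r (g0 y) h) _.
  by rewrite /A /K -/th -/p le_eqVlt; apply/orP; left; apply/eqP; ring.
rewrite ge0_integralZl_EFin//; last 2 first.
- by move=> z _; rewrite adde_ge0// lee_fin powR_ge0.
- by apply: emeasurable_funD; apply/measurable_EFinP; exact: measurable_riesz_kernel.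
rewrite ge0_integralD//; last 4 first.
- by move=> z _; rewrite lee_fin powR_ge0.
- by apply/measurable_EFinP; exact: measurable_riesz_kernel.
- by move=> z _; rewrite lee_fin powR_ge0.
- by apply/measurable_EFinP; exact: measurable_riesz_kernel.
apply: (@le_trans _ _ (A%:E * (C + C)%:E)%E).
  by rewrite lee_wpmul2l ?lee_fin// EFinD leeD// HC.
by rewrite -EFinM lee_fin /A le_eqVlt; apply/orP; left; apply/eqP; ring.
Qed.

End riesz_iteration.

(** * Bounded functions and L^1 norms on a set of finite measure *)

Section leb_bounded.
Context {R : realType} {n : nat}.
Local Notation E := 'rV[R]_n.
Variable Om : bounded_domain R n.
Local Notation mu := (leb Om).

Lemma ae_bounded_Lfun2 (f : E -> R) (B : R) : measurable_fun setT f ->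
  (\forall x \ae mu, `|f x| <= B) -> f \in Lfun mu 2%:E.
Proof.
move=> mf fB; apply/Lfun2P; split => //.
have m2 : measurable_fun setT (fun x => (f x ^+ 2)%:E).
  by apply/measurable_EFinP; exact: measurable_funX.
apply/integrableP; split => //.
apply: (@le_lt_trans _ _ (\int[mu]_x (cst (B ^+ 2)%:E x))%E); last first.
  rewrite integral_cst// lte_mul_pinfty ?lee_fin ?sqr_ge0//.
  exact: leb_lty.
apply: ae_ge0_le_integral => //.
- exact: measurableT_comp.
- by move=> x _ /=; rewrite lee_fin sqr_ge0.
apply: filterS fB => x fxB _ /=.
rewrite lee_fin ger0_norm ?sqr_ge0// -real_normK ?num_real//.
by rewrite ler_pXn2r ?nnegrE// (le_trans _ fxB).
Qed.

Lemma integral_abs_le_rnorm2 : exists2 C : R, 0 < C &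
  forall f : E -> R, f \in Lfun mu 2%:E ->
    (\int[mu]_x `|f x|%:E <= (C * rnorm2 mu f)%:E)%E.
Proof.
have L1 : (cst 1 : E -> R) \in Lfun mu 2%:E.
  by apply: (@ae_bounded_Lfun2 _ 1) => //; apply: nearW => x; rewrite normr1.
exists (rnorm2 mu (cst 1) + 1) => [|f fL]; first by rewrite ltr_wpDl ?rnorm2_ge0.
have mf := Lfun_measurable fL.
have fL' : (fun x => `|f x|) \in Lfun mu 2%:E.
  apply/Lfun2P; split; first exact: measurableT_comp.
  have /Lfun2P[_] := fL; apply: eq_integrable => // x _.
  by rewrite real_normK ?num_real.
have -> : (\int[mu]_x `|f x|%:E = (\int[mu]_x (`|f x| * cst 1 x))%:E)%E.
  rewrite /Rintegral fineK.
    by apply: eq_integral => x _; rewrite mulr1.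
  exact: (integrable_fin_num measurableT (Lfun2_integrableM fL' L1)).
rewrite lee_fin; apply: le_trans (ler_norm _) _.
apply: le_trans (ip_CauchySchwarz fL' L1) _.
have -> : rnorm2 mu (fun x => `|f x|) = rnorm2 mu f.
  congr Num.sqrt; apply: eq_Rintegral => x _.
  by rewrite -!expr2 real_normK ?num_real.
by rewrite mulrC ler_wpM2r ?rnorm2_ge0// lerDl.
Qed.

End leb_bounded.

(** * Pointwise bounds for iterates of the Green operator *)

Section green_bounds.
Context {R : realType} {n : nat}.
Local Notation E := 'rV[R]_n.
Variables (Om : bounded_domain R n) (G : E -> E -> \bar R).
Variables (phi : nat -> E -> R) (lam : nat -> R) (s gam : R).
Local Notation mu := (leb Om).
Local Notation lambda := (@lebesgue_rV R n).
Local Notation L2 := (Lfun mu 2%:E).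
Local Notation Gop := (green_op Om G).
Hypothesis s01 : 0 < s < 1.
Hypothesis gam01 : 0 < gam <= 1.
Hypothesis s2n : 2 * s < n%:R.
Hypothesis HG : green_eigensystem Om G phi lam.
Hypothesis HE : green_estimate Om G s gam.

Lemma dimension_gt0 : (0 < n)%N.
Proof. by rewrite -(ltr0n R); have s2n' := s2n; case/andP: s01 => s0 _; lra. Qed.

Let n0 := dimension_gt0.

Lemma green_opE f x : dom Om x ->
  Gop f x = fine (\int[lambda]_(y in dom Om) (G x y * (f y)%:E))%E.
Proof. by move=> Ox; rewrite /green_op patchE mem_set. Qed.

Lemma measurable_green_section x : dom Om x ->
  measurable_fun (dom Om) (fun y => G x y).
Proof.
move=> Ox; have mO := measurable_dom Om.
have mGt : measurable_fun setT ((fun p : E * E => G p.1 p.2) \_ (dom Om `*` dom Om)).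
  apply/(measurable_restrictT _ (measurableX mO mO)).
  exact: (green_measurable HG).
have := measurable_funTS (D := dom Om) (measurableT_comp mGt (measurable_pair1 x)).
apply: eq_measurable_fun => y; rewrite inE => Oy.
by rewrite /= patchE mem_set.
Qed.

(** The majorant is asked for off the diagonal only, where the Green estimate holds; for fixed [x]
    the diagonal is the null set [[set x]]. *)
Lemma green_op_le (f : E -> R) x (h : E -> \bar R) :
  measurable_fun setT f -> dom Om x -> measurable_fun setT h ->
  (forall y, 0 <= h y)%E ->
  (forall y, dom Om y -> x != y -> G x y * `|f y|%:E <= h y)%E ->
  (`|Gop f x|%:E <= \int[mu]_y h y)%E.
Proof.
move=> mf Ox mh h0 fh; have mO := measurable_dom Om.
rewrite green_opE// integral_leb_dom//.
have mGf : measurable_fun (dom Om) (fun y => G x y * (f y)%:E)%E.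
  apply: emeasurable_funM; first exact: measurable_green_section.
  by apply/measurable_EFinP; exact: measurable_funTS.
apply: (@le_trans _ _ `|\int[lambda]_(y in dom Om) (G x y * (f y)%:E)|%E).
  (* If the integral is infinite, [fine] returns [0]; hence no integrability is assumed. *)
  by case: (integral _ _ _) => [r||]//=; rewrite normr0 leey.
apply: le_trans (le_abse_integral _ mO mGf) _.
apply: ae_ge0_le_integral => //.
- exact: measurableT_comp.
- exact: measurable_funTS.
exists [set x]; split.
- exact: measurable_rV_set1.
- exact: lebesgue_rV_point.
move=> y /= hy; apply: contrapT => /eqP yx; apply: hy => Oy.
rewrite abseM gee0_abs; last exact: (green_ge0 HG).
by rewrite abse_EFin; apply: fh; rewrite // eq_sym.
Qed.

(** The weight is kept apart from an arbitrary majorant [I], so that the step can be repeated with a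
    Riesz potential of the datum in the place of [I]. *)
Lemma green_step (a a' : R) : 0 <= a -> a <= a' -> a' <= a + s -> a' <= gam ->
  exists2 K : R, 0 < K & forall (f : E -> R) (I : E -> \bar R),
    measurable_fun setT f -> measurable_fun setT I -> (forall z, 0 <= I z)%E ->
    (forall z, dom Om z -> `|f z|%:E <= (bdist Om z `^ a)%:E * I z)%E ->
    forall x, dom Om x ->
    (`|Gop f x|%:E <= (K * bdist Om x `^ a')%:E *
       \int[mu]_z ((enorm (x - z) `^ (- (n%:R - s)))%:E * I z))%E.
Proof.
move=> a0 aa' a's a'g.
have [D D1 [_ OD]] := dom_diameter Om n0.
have [_ [cg [Cg [_ Cg0 GC]]]] := HE.
have D0 : 0 < D by rewrite (lt_le_trans ltr01).
pose K := Cg * (4 * D `^ s).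
have K0 : 0 < K by rewrite !mulr_gt0 ?powR_gt0.
exists K => // f I mf mI I0 fI x Ox.
have mk : measurable_fun setT (fun z : E => (enorm (x - z) `^ (- (n%:R - s)))%:E * I z)%E.
  apply: emeasurable_funM => //; apply/measurable_EFinP.
  exact: measurable_riesz_kernel.
have k0 z : (0 <= (enorm (x - z) `^ (- (n%:R - s)))%:E * I z)%E.
  by rewrite mule_ge0// lee_fin powR_ge0.
have Kx0 : 0 <= K * bdist Om x `^ a' by rewrite mulr_ge0 ?powR_ge0// ltW.
rewrite -ge0_integralZl_EFin//.
apply: green_op_le => //.
- exact: measurable_funeM.
- by move=> z; rewrite mule_ge0.
move=> z Oz xz; have /andP[_ Gxz] := GC x z Ox Oz xz.
have prof0 : 0 <= green_profile Om s gam x z by rewrite mulr_ge0 ?powR_ge0.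
apply: (@le_trans _ _ ((Cg * green_profile Om s gam x z)%:E *
   ((bdist Om z `^ a)%:E * I z))%E).
  by apply: lee_pmul => //; [exact: (green_ge0 HG)|exact: fI].
rewrite [leLHS]muleA [leRHS]muleA; apply: lee_wpmul2r => //.
rewrite -!EFinM lee_fin /K.
have rp : 0 < enorm (x - z) by rewrite enorm_gt0// subr_eq0.
have tri : bdist Om z <= bdist Om x + enorm (x - z).
  by rewrite enormB; exact: bdist_lipschitz.
case/andP: s01 => s0 _; case/andP: gam01 => _ g1.
have ca0 : 0 <= a' - a by rewrite subr_ge0.
have cas : a' - a <= s by rewrite lerBlDl.
have acg : a + (a' - a) <= gam by rewrite addrC subrK.
have := @profile_weight R D n%:R s gam a (a' - a) _ _ _ D1
  (bdist_gt0 n0 Ox) (bdist_gt0 n0 Oz) rp (OD _ _ Ox Oz) tri a0 ca0 cas acg g1.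
rewrite (_ : a + (a' - a) = a'); last by ring.
rewrite /green_profile => h.
have h' := ler_wpM2l (ltW Cg0) h.
by apply: le_trans (le_trans _ h') _; rewrite le_eqVlt; apply/orP; left; apply/eqP; ring.
Qed.

Lemma iter_green_L2 j f : f \in L2 -> iter j Gop f \in L2.
Proof. by move=> fL; elim: j => //= j ih; exact: (green_L2 HG). Qed.

(** After [j.+1] applications of the Green operator the weight has exponent [wexp j.+1] and the
    remaining kernel has singularity exponent [kexp j]. *)
Let wexp (j : nat) : R := Num.min gam (j%:R * s).
Let kexp (j : nat) : R := iter j (fun b => Num.max 0 (b - s / 2)) (n%:R - s).

Let wexpP j : [/\ 0 <= wexp j, wexp j <= wexp j.+1, wexp j.+1 <= wexp j + s &
  wexp j.+1 <= gam].
Proof.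
case/andP: s01 => s0 _; case/andP: gam01 => g0 _.
have js : 0 <= j%:R * s by rewrite mulr_ge0// ltW.
rewrite /wexp -natr1 mulrDl mul1r.
have [h1|h1] := leP gam (j%:R * s); have [h2|h2] := leP gam (j%:R * s + s);
  split; lra.
Qed.

Let kexpP j : 0 <= kexp j <= n%:R - s.
Proof.
have s2n' := s2n.
case/andP: s01 => s0 _.
elim: j => [|j /andP[k0 kn]]; first by rewrite /kexp/=; apply/andP; split; lra.
rewrite /kexp/= -/(kexp j); by rewrite le_max lexx/= ge_max; apply/andP; split; lra.
Qed.

Let kexp_le j : kexp j <= Num.max 0 (n%:R - s - j%:R * (s / 2)).
Proof.
case/andP: s01 => s0 _.
elim: j => [|j ih]; first by rewrite mul0r subr0 le_max lexx orbT.
rewrite /kexp/= -/(kexp j) ge_max le_max lexx/= -(@natr1 R j) mulrDl mul1r.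
move: ih; rewrite !le_max => /orP[ih|ih]; apply/orP; [left|right]; lra.
Qed.

Lemma iter_green_riesz j : exists2 C : R, 0 < C & forall f, f \in L2 ->
  forall x, dom Om x -> (`|iter j.+1 Gop f x|%:E <=
    (C * bdist Om x `^ wexp j.+1)%:E *
    riesz_potential Om (kexp j) (fun y => `|f y|)%R x)%E.
Proof.
case/andP: s01 => s0 s1.
elim: j => [|j [C C0 IH]].
  have [w0 w1 w2 w3] := wexpP 0.
  have we0 : wexp 0 = 0.
    by rewrite /wexp mul0r; apply: min_r; case/andP: gam01 => /ltW.
  have [K K0 HK] := green_step w0 w1 w2 w3.
  exists K => // f fL x Ox; have mf := Lfun_measurable fL.
  have := HK f (fun z => `|f z|%:E) mf _ _ _ x Ox.
  have mnf : measurable_fun setT (fun z : E => `|f z|%:E).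
    by apply/measurable_EFinP; exact: measurableT_comp.
  move=> /(_ mnf (fun=> _))/=; apply => [z|z Oz]; first by rewrite lee_fin.
  by rewrite we0 powRr0 mul1e.
have [w0 w1 w2 w3] := wexpP j.+1.
have [K K0 HK] := green_step w0 w1 w2 w3.
have /andP[k0 kn] := kexpP j.
have sn : s < n%:R by have s2n' := s2n; lra.
have [K' K'0 HK'] := riesz_potential_iter Om n0 s0 sn k0 kn.
exists (K * C * K') => [|f fL x Ox]; first by rewrite !mulr_gt0.
have mf := Lfun_measurable fL.
have mnf : measurable_fun setT (fun z : E => `|f z|).
  exact: measurableT_comp.
have nf0 (y : E) : 0 <= `|f y| by [].
pose I z := (C%:E * riesz_potential Om (kexp j) (fun y => `|f y|)%R z)%E.
have mI : measurable_fun setT I.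
  by apply: measurable_funeM; exact: measurable_riesz_potential.
have I0 z : (0 <= I z)%E.
  by rewrite mule_ge0 ?riesz_potential_ge0// lee_fin ltW.
have fI z : dom Om z -> (`|iter j.+1 Gop f z|%:E <= (bdist Om z `^ wexp j.+1)%:E * I z)%E.
  by move=> Oz; rewrite /I muleA -EFinM [_ * C]mulrC; exact: IH.
have := HK (iter j.+1 Gop f) I (Lfun_measurable (iter_green_L2 j.+1 fL)) mI I0 fI x Ox.
rewrite -[iter j.+2 Gop f]/(Gop (iter j.+1 Gop f)).
move=> /le_trans; apply.
apply: (@le_trans _ _ ((K * bdist Om x `^ wexp j.+2)%:E * (C%:E * (K'%:E *
    riesz_potential Om (kexp j.+1) (fun y => `|f y|)%R x)))%E); last first.
  rewrite !muleA le_eqVlt; apply/orP; left; apply/eqP.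
  by congr (_ * _)%E; rewrite -!EFinM; congr (_%:E); ring.
apply: lee_wpmul2l; first by rewrite lee_fin mulr_ge0 ?powR_ge0// ltW.
under eq_integral do rewrite /I muleCA.
rewrite ge0_integralZl_EFin ?(ltW C0)//.
- by apply: lee_wpmul2l; [rewrite lee_fin ltW|exact: HK'].
- by move=> z _; rewrite mule_ge0 ?lee_fin ?powR_ge0// riesz_potential_ge0.
- apply: emeasurable_funM; last exact: measurable_riesz_potential.
  by apply/measurable_EFinP; exact: measurable_riesz_kernel.
Qed.

(** Both exponents have reached their final values [gam] and [0]: the kernel is then identically
    [1], also on the diagonal, and the potential is the L^1 norm of [f]. *)
Lemma iter_green_sup : exists M : nat, forall m, (M < m)%N ->
  exists2 C : R, 0 < C & forall f, f \in L2 -> forall x, dom Om x ->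
    `|iter m Gop f x| <= C * bdist_pow Om gam x * rnorm2 mu f.
Proof.
case/andP: s01 => s0 _; case/andP: gam01 => _ g1.
(* From [J] on, [j * (s / 2)] exceeds [n], which exhausts the kernel exponent, and also [1 >= gam],
   which saturates the weight. *)
pose J := Num.bound ((n%:R + 1) / (s / 2)).
have JP : n%:R + 1 < J%:R * (s / 2).
  rewrite -ltr_pdivrMr; last lra.
  by apply: archi_boundP; rewrite divr_ge0// ?addr_ge0//; lra.
exists J => -[//|j]; rewrite ltnS => Jj.
have jP : n%:R + 1 < j%:R * (s / 2).
  apply: (lt_le_trans JP); rewrite ler_wpM2r ?ler_nat//; lra.
have n0' : 0 <= n%:R :> R by [].
have s2n' := s2n.
have kj : kexp j = 0.
  have := kexp_le j; rewrite max_l; last lra.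
  by have /andP[k0 _] := kexpP j; move=> k1; apply/eqP; rewrite eq_le k1.
have wj : wexp j.+1 = gam.
  by rewrite /wexp; apply: min_l; rewrite -natr1 mulrDl; lra.
have [C C0 HC] := iter_green_riesz j.
have [C1 C10 HC1] := integral_abs_le_rnorm2 Om.
exists (C * C1) => [|f fL x Ox]; first exact: mulr_gt0.
rewrite -lee_fin; apply: le_trans (HC f fL x Ox) _.
rewrite wj kj /riesz_potential.
under eq_integral do rewrite oppr0 powRr0 mul1r.
apply: le_trans (lee_wpmul2l _ (HC1 f fL)) _.
  by rewrite lee_fin mulr_ge0 ?powR_ge0// ltW.
rewrite -EFinM lee_fin /bdist_pow le_eqVlt; apply/orP; left; apply/eqP; ring.
Qed.

End green_bounds.

(** * Exponential decay against powers *)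

Section rapidly_decaying_sums.
Context {R : realType}.

Lemma exprn_expR_le (t : R) (q : nat) : 0 < t -> exists2 C : R, 0 < C &
  forall l : R, 0 < l -> l ^+ q * expR (- l * t) <= C.
Proof.
(* With [y = l * t / q.+1], the inequality 1 + y <= exp(y) gives y^q <= exp(q y) <= exp(l t); [q.+1]
   avoids a division by zero when [q = 0]. *)
move=> t0; exists ((q.+1%:R / t) ^+ q) => [|l l0].
  by rewrite exprn_gt0// divr_gt0.
rewrite mulNr expRN ler_pdivrMr ?expR_gt0//.
have lt0 : 0 <= l * t / q.+1%:R by rewrite divr_ge0// mulr_ge0// ltW.
have -> : l ^+ q = (q.+1%:R / t) ^+ q * (l * t / q.+1%:R) ^+ q.
  rewrite -exprMn; congr (_ ^+ _); field.
  by rewrite (gt_eqF t0) andbT addrC natr1 pnatr_eq0.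
rewrite ler_wpM2l// ?exprn_ge0 ?divr_ge0// ?(ltW t0)//.
apply: (@le_trans _ _ (expR (l * t / q.+1%:R) ^+ q)).
  rewrite lerXn2r ?nnegrE ?expR_ge0//.
  by apply: le_trans (expR_ge1Dx _); rewrite lerDr.
rewrite -expRM_natl ler_expR mulrA ler_pdivrMr//.
by rewrite mulrC ler_wpM2l ?mulr_ge0 ?(ltW l0) ?(ltW t0)// ler_nat.
Qed.

End rapidly_decaying_sums.

(** * The space delta^gamma C(closure Om) and passage from almost everywhere to pointwise *)

Section weighted_continuous.
Context {R : realType} {n : nat}.
Local Notation E := 'rV[R]_n.
Variables (Om : bounded_domain R n) (gam : R).
Local Notation mu := (leb Om).
Local Notation w := (bdist_pow Om gam).
Hypothesis n0 : (0 < n)%N.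
Hypothesis gam0 : 0 < gam.
Local Notation wC := (wspace Om w (C_closure Om)).

Lemma wspace_continuous (u : E -> R) : wC u -> {within dom Om, continuous u}.
Proof.
move=> [v cv uv].
have cv' : {within dom Om, continuous v}.
  by apply: continuous_subspaceW cv; exact: subset_closure.
rewrite (continuous_open_subspace _ (@dom_open _ _ Om)) => x; rewrite inE => Ox.
have := cv'; rewrite (continuous_open_subspace _ (@dom_open _ _ Om)).
move=> /(_ x (mem_set Ox)) cvx.
have : {near nbhs x, (fun y => w y * v y) =1 u}.
  apply: filterS (open_nbhs_nbhs (conj (@dom_open _ _ Om) Ox)) => y Oy.
  by rewrite uv.
move=> h; apply: cvg_trans (near_eq_cvg h) _.
rewrite uv//; apply: cvgM; last exact: cvx.
by apply: continuous_bdist_pow.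
Qed.

(** Members of this space are continuous on the open domain, so their class modulo null sets
    determines their values there. *)
Lemma wspace_ae_eq (u u' : E -> R) : wC u -> wC u' -> u = u' %[ae mu] ->
  forall x, dom Om x -> u x = u' x.
Proof. by move=> /wspace_continuous cu /wspace_continuous cu'; exact: ae_eq_continuous_dom. Qed.

Lemma wspaceZ a (u : E -> R) : wC u -> wC (fun x => a * u x).
Proof.
move=> [v cv uv]; exists (fun x => a * v x); last first.
  by move=> x Ox; rewrite uv// mulrCA.
by move=> x; apply: cvgM; [exact: cvg_cst|exact: cv].
Qed.

Lemma wspaceD (u u' : E -> R) : wC u -> wC u' -> wC (fun x => u x + u' x).
Proof.
move=> [v cv uv] [v' cv' uv']; exists (fun x => v x + v' x); last first.
  by move=> x Ox; rewrite uv// uv'// mulrDr.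
by move=> x; apply: cvgD; [exact: cv|exact: cv'].
Qed.

Lemma wspace_sum (u : nat -> E -> R) (a : nat -> R) K : (forall k, wC (u k)) ->
  wC (fun x => \sum_(k < K) a k * u k x).
Proof.
move=> uC; elim: K => [|K ih].
  exists (cst 0); last by move=> x _; rewrite big_ord0 mulr0.
  by move=> x; exact: cvg_cst.
rewrite (_ : (fun x => _) = fun x => \sum_(k < K) a k * u k x + a K * u K x).
  by apply: wspaceD => //; exact: wspaceZ.
by apply/funext => x; rewrite big_ord_recr.
Qed.

Lemma ae_le_continuous_dom (u : E -> R) (b : R) : {within dom Om, continuous u} ->
  (\forall x \ae mu, b <= u x) -> forall x, dom Om x -> b <= u x.
Proof.
move=> cu ub x Ox; rewrite leNgt; apply/negP => uxb.
have := cu; rewrite (continuous_open_subspace _ (@dom_open _ _ Om)) => /(_ x (mem_set Ox)).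
have e0 : 0 < b - u x by rewrite subr_gt0.
move=> /(iffLR (@cvgrPdist_lt R R^o _ (nbhs x) (nbhs_filter x) u (u x))) /(_ _ e0) ux.
have [z [Oz bz]] := ae_open_dense ub Ox ux.
by rewrite ltr_norml => /andP[h _]; lra.
Qed.

Lemma bdist_pow_bounded : exists2 D : R, 0 < D & forall x, w x <= D.
Proof.
have [D D1 [OD _]] := dom_diameter Om n0.
exists (D `^ gam) => [|x]; first by rewrite powR_gt0// (lt_le_trans ltr01).
have [Ox|Ox] := pselect (dom Om x); last by rewrite bdist_pow_out// powR_ge0.
apply: ge0_ler_powR; rewrite ?nnegrE ?bdist_ge0//; [exact: ltW|lra|exact: OD].
Qed.

Lemma bdist_pow_L2 : w \in Lfun mu 2%:E.
Proof.
have [D D0 wD] := bdist_pow_bounded.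
apply: (@ae_bounded_Lfun2 _ _ _ _ D); first exact: measurable_bdist_pow.
by apply: nearW => x; rewrite ger0_norm ?bdist_pow_ge0.
Qed.

Lemma weighted_Lfun2 (u : E -> R) (B : R) : measurable_fun setT u ->
  (forall x, dom Om x -> `|u x| <= B * w x) -> u \in Lfun mu 2%:E.
Proof.
move=> mu' uB; have [D D0 wD] := bdist_pow_bounded.
apply: (@ae_bounded_Lfun2 _ _ _ _ (`|B| * D)) => //.
apply: filterS (ae_dom Om) => x Ox; apply: le_trans (uB x Ox) _.
apply: (@le_trans _ _ (`|B| * w x)).
  by rewrite ler_wpM2r ?bdist_pow_ge0// ler_norm.
by rewrite ler_wpM2l.
Qed.

Lemma Lnorm_infty_le (u : E -> R) (B : R) : 0 <= B ->
  (\forall x \ae mu, `|u x| <= B) -> ('N[mu]_+oo[EFin \o u] <= B%:E)%E.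
Proof.
move=> B0 uB; rewrite unlock; case: ifPn => // _.
by apply/ess_sup_inf.ess_supP.
Qed.

Lemma Lfun_infty (u : E -> R) (B : R) : 0 <= B -> measurable_fun setT u ->
  (\forall x \ae mu, `|u x| <= B) -> u \in Lfun mu +oo%E.
Proof.
move=> B0 mu' uB; apply/andP; split; rewrite inE//=; rewrite /finite_norm.
by apply: le_lt_trans (Lnorm_infty_le B0 uB) _; rewrite ltry.
Qed.

End weighted_continuous.

(** * Regular representatives of the eigenfunctions and growth of the eigenvalues *)

Section eigenfunctions.
Context {R : realType} {n : nat}.
Local Notation E := 'rV[R]_n.
Variables (Om : bounded_domain R n) (G : E -> E -> \bar R).
Variables (phi : nat -> E -> R) (lam : nat -> R) (s gam : R).
Local Notation mu := (leb Om).
Local Notation lambda := (@lebesgue_rV R n).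
Local Notation L2 := (Lfun mu 2%:E).
Local Notation Gop := (green_op Om G).
Local Notation w := (bdist_pow Om gam).
Local Notation wC := (wspace Om w (C_closure Om)).
Local Notation ip f g := (\int[mu]_x (f x * g x)).
Hypothesis s01 : 0 < s < 1.
Hypothesis gam01 : 0 < gam <= 1.
Hypothesis s2n : 2 * s < n%:R.
Hypothesis HG : green_eigensystem Om G phi lam.
Hypothesis HE : green_estimate Om G s gam.
Hypothesis HC : continuous_op
    (wspace Om w (Lp Om +oo%E)) (wdist w (Lp_norm Om +oo%E))
    wC (wdist w (C_norm Om)) (green_graph Om G).

Let n0 : (0 < n)%N. Proof. exact: dimension_gt0 s01 s2n. Qed.
Let gam0 : 0 < gam. Proof. by case/andP: gam01. Qed.

Lemma green_op_lebE f x : dom Om x ->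
  Gop f x = fine (\int[mu]_(y in dom Om) (G x y * (f y)%:E))%E.
Proof.
move=> Ox; rewrite green_opE//; congr fine; apply: eq_measure_integral => A mA AO.
by rewrite leb_lebesgue.
Qed.

Lemma green_op_ae_eq f g : measurable_fun setT f -> measurable_fun setT g ->
  f = g %[ae mu] -> forall x, dom Om x -> Gop f x = Gop g x.
Proof.
move=> mf mg fg x Ox; rewrite !green_op_lebE//; congr fine.
have mG := measurable_green_section HG Ox.
apply: ae_eq_integral; first exact: measurable_dom.
- by apply: emeasurable_funM => //; apply/measurable_EFinP; exact: measurable_funTS.
- by apply: emeasurable_funM => //; apply/measurable_EFinP; exact: measurable_funTS.
by apply: filterS fg => y /(_ I) -> _.
Qed.

Lemma integrable_leb (F : E -> \bar R) :
  lambda.-integrable (dom Om) F -> mu.-integrable (dom Om) F.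
Proof.
move=> /integrableP[mF iF]; apply/integrableP; split => //.
by rewrite (eq_measure_integral lambda)// => A mA AO; exact: leb_lebesgue.
Qed.

(** Additivity of the integral is available where both integrands are integrable, which is known for
    almost every [x]; at other points [fine] may return a default value. *)
Lemma green_op_linear f g a : f \in L2 -> g \in L2 ->
  \forall x \ae mu, Gop (fun y => f y + a * g y) x = Gop f x + a * Gop g x.
Proof.
move=> fL gL.
apply: filterS3 (ae_dom Om) (green_integrable HG fL) (green_integrable HG gL).
move=> x Ox /integrable_leb If /integrable_leb Ig; rewrite !green_op_lebE//.
have mO := measurable_dom Om; have mG := measurable_green_section HG Ox.
rewrite (@ae_eq_integral _ _ _ mu (dom Om)
    (fun y => G x y * (f y)%:E + a%:E * (G x y * (g y)%:E))%E)//.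
- have fF := integrable_fin_num mO If; have fG := integrable_fin_num mO Ig.
  rewrite integralD//; last by apply: integrableZl.
  by rewrite integralZl// fineD ?fineM// fin_numM.
- apply: emeasurable_funM => //; apply/measurable_EFinP; apply: measurable_funTS.
  exact: Lfun_measurable (Lfun2D fL (Lfun2Z a gL)).
- by apply: emeasurable_funD; [case/integrableP: If|apply: measurable_funeM; case/integrableP: Ig].
apply: filterS (ae_neq Om n0 x) => y yx Oy.
(* Distributing [G x y] over the sum requires it to be finite, which the upper Green estimate gives
   off the diagonal. *)
have [_ [c [Cg [_ _ GC]]]] := HE.
have Gfin : G x y \is a fin_num.
  rewrite ge0_fin_numE ?(green_ge0 HG)//.
  have xy : x != y by rewrite eq_sym.
  have /andP[_ h] := GC x y Ox Oy xy.
  by apply: le_lt_trans h _; rewrite ltry.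
by rewrite EFinD muleDr// EFinM muleCA.
Qed.

Lemma lam_ge k : lam 0%N <= lam k.
Proof. by elim: k => // k ih; apply: le_trans ih (eigen_mono HG k). Qed.

Lemma lam_gt0 k : 0 < lam k.
Proof. exact: lt_le_trans (eigen_gt0 HG) (lam_ge k). Qed.

Lemma green_op_eigensum (a : nat -> R) K :
  Gop (fun x => \sum_(k < K) a k * phi k x) =
  (fun x => \sum_(k < K) (a k / lam k) * phi k x) %[ae mu].
Proof.
have pL := eigen_L2 HG.
elim: K => [|K ih].
  apply: filterS (ae_dom Om) => x Ox _; rewrite big_ord0 green_opE//.
  under eq_integral do rewrite big_ord0 mule0.
  by rewrite integral0.
have sL : (fun x => \sum_(k < K) a k * phi k x) \in L2 by exact: Lfun2_sum.
apply: filterS3 ih (green_op_linear (a K) sL (pL K)) (eigenE HG K).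
move=> x /(_ I) h1 + /(_ I) h3 _.
rewrite (_ : (fun y => \sum_(k < K) a k * phi k y + a K * phi K y) =
  fun y => \sum_(k < K.+1) a k * phi k y); last first.
  by apply/funext => y; rewrite big_ord_recr.
by move=> ->; rewrite h1 h3 big_ord_recr/= mulrA.
Qed.

Lemma iter_green_eigensum (a : nat -> R) K m :
  iter m Gop (fun x => \sum_(k < K) a k * phi k x) =
  (fun x => \sum_(k < K) (a k / lam k ^+ m) * phi k x) %[ae mu].
Proof.
have pL := eigen_L2 HG.
elim: m => [|m ih].
  by apply: nearW => x _ /=; apply: eq_bigr => k _; rewrite expr0 divr1.
have sL (b : nat -> R) : (fun x => \sum_(k < K) b k * phi k x) \in L2.
  by apply: (@Lfun2_sum _ _ _ mu phi b K).
apply: filterS2 (ae_dom Om) (green_op_eigensum (fun k => a k / lam k ^+ m) K).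
move=> x Ox /(_ I) h _ /=.
rewrite (green_op_ae_eq _ _ ih Ox); last 2 first.
- exact: Lfun_measurable (iter_green_L2 HG _ (sL a)).
- exact: Lfun_measurable (sL (fun k => a k / lam k ^+ m)).
by rewrite h; apply: eq_bigr => k _; rewrite exprSr invfM mulrA.
Qed.

(* One more iteration turns the bounded quotient into a continuous one, by the
   hypothesis on the Green operator. *)
Lemma iter_green_regular : exists N : nat,
  [/\ (0 < N)%N,
      forall f, f \in L2 -> wC (iter N Gop f) &
      exists2 C : R, 0 < C & forall f, f \in L2 -> forall x, dom Om x ->
        `|iter N Gop f x| <= C * w x * rnorm2 mu f].
Proof.
have [M HM] := iter_green_sup s01 gam01 s2n HG HE.
exists M.+2; split => //; last by apply: HM; rewrite ltnS leqnSn.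
move=> f fL; have [C C0 HC1] := HM M.+1 (ltnSn M).
set g := iter M.+1 Gop f.
have gL : g \in L2 by exact: (iter_green_L2 HG M.+1 fL).
have mg := Lfun_measurable gL.
have gW : wspace Om w (Lp Om +oo%E) g.
  exists (fun x => g x / w x); last first.
    by move=> x Ox; rewrite mulrC divfK// gt_eqF// bdist_pow_gt0.
  apply: (@Lfun_infty _ _ _ _ (C * rnorm2 mu f)).
  - by rewrite mulr_ge0 ?rnorm2_ge0// ltW.
  - apply: measurable_funM => //.
    rewrite (_ : (fun x => _) = fun x => w x `^ (-1)); last first.
      by apply/funext => x; rewrite powR_inv1 ?bdist_pow_ge0.
    by apply: (measurableT_comp (measurable_powR _)); exact: measurable_bdist_pow.
  apply: filterS (ae_dom Om) => x Ox; have wx := bdist_pow_gt0 n0 gam Ox.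
  rewrite normrM normfV (ger0_norm (ltW wx)) ler_pdivrMr// mulrAC.
  exact: HC1.
have [[b [v cv bv] gb] _] := HC gW.
by exists v => // x Ox; rewrite -bv//= -gb.
Qed.

Definition eigen_rep (N k : nat) (x : E) : R := lam k ^+ N * iter N Gop (phi k) x.

Lemma eigen_rep_ae N k : eigen_rep N k = phi k %[ae mu].
Proof.
pose a j : R := (j == k)%:R.
have sE : (fun x => \sum_(j < k.+1) a j * phi j x) = phi k.
  apply/funext => x; rewrite big_ord_recr/= /a eqxx mul1r big1 ?add0r// => j _.
  by rewrite ltn_eqF ?mul0r.
have := iter_green_eigensum a k.+1 N; rewrite sE.
apply: filterS => x /(_ I) h _; rewrite /eigen_rep h big_ord_recr/= /a eqxx.
rewrite big1 ?add0r => [|j _]; last by rewrite ltn_eqF ?mul0r.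
by rewrite mul1r mulrA mulfV ?mul1r// expf_neq0// gt_eqF// lam_gt0.
Qed.

Lemma eigen_rep_L2 N k : eigen_rep N k \in L2.
Proof. by apply: Lfun2Z; apply: iter_green_L2 HG _ _ _; exact: (eigen_L2 HG). Qed.

(** [green_op] is patched by [0] off the domain, where the weight vanishes as well; with [0 < N] the
    bounds below therefore hold at every point of the space. *)
Lemma eigen_rep_out N k x : (0 < N)%N -> ~ dom Om x -> eigen_rep N k x = 0.
Proof.
case: N => // N _ Ox; rewrite /eigen_rep iterS /green_op patchE memNset//=.
by rewrite mulr0.
Qed.

Section regular_index.
Variables (N : nat) (C : R).
Hypothesis N0 : (0 < N)%N.
Hypothesis NwC : forall f, f \in L2 -> wC (iter N Gop f).
Hypothesis C0 : 0 < C.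
Hypothesis NC : forall f, f \in L2 -> forall x, dom Om x ->
        `|iter N Gop f x| <= C * w x * rnorm2 mu f.
Local Notation psi := (eigen_rep N).

Lemma eigen_rep_wspace k : wC (psi k).
Proof. by apply: wspaceZ; apply: NwC; exact: (eigen_L2 HG). Qed.

Lemma eigen_norm1 k : rnorm2 mu (phi k) = 1.
Proof. by rewrite /rnorm2 [X in Num.sqrt X](eigen_orthonormal HG) eqxx sqrtr1. Qed.

Lemma eigen_rep_le k x : `|psi k x| <= C * lam k ^+ N * w x.
Proof.
have lk := exprn_gt0 N (lam_gt0 k).
have [Ox|Ox] := pselect (dom Om x); last first.
  by rewrite eigen_rep_out// normr0 !mulr_ge0 ?bdist_pow_ge0// ltW.
rewrite normrM (ger0_norm (ltW lk)) [C * _]mulrC -mulrA ler_wpM2l ?(ltW lk)//.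
by have := NC (eigen_L2 HG k) Ox; rewrite eigen_norm1 mulr1.
Qed.

(** The summed quantities are squared coefficients of the functional evaluating the [N]-th Green
    iterate at [x]. The test function [f] is the truncated Riesz representative of this functional,
    so that its value on [f] is the squared norm [A]; then A <= C w(x) sqrt(A). *)
Lemma eigen_rep_sum_sqr K x :
  \sum_(k < K) (psi k x / lam k ^+ N) ^+ 2 <= C ^+ 2 * w x ^+ 2.
Proof.
have pL := eigen_L2 HG.
have [Ox|Ox] := pselect (dom Om x); last first.
  rewrite big1 => [|k _]; first by apply: mulr_ge0; exact: sqr_ge0.
  by rewrite eigen_rep_out// mul0r expr0n.
pose a k := psi k x / lam k ^+ N.
set A := \sum_(k < K) _.
have A0 : 0 <= A by apply: sumr_ge0 => k _; exact: sqr_ge0.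
pose f y := \sum_(k < K) a k * phi k y.
have fL : f \in L2 by exact: Lfun2_sum.
have fA : rnorm2 mu f ^+ 2 = A.
  by rewrite /f (rnorm2_orthonormal_sum pL (eigen_orthonormal HG)).
(* The expansion of the iterate is only known almost everywhere; both sides are weighted continuous
   functions, so it holds at the given [x]. *)
have NfE : iter N Gop f x = A.
  have -> : A = \sum_(k < K) (a k / lam k ^+ N) * psi k x.
    by apply: eq_bigr => k _; rewrite expr2 -[in RHS]mulrA [_^-1 * psi _ _]mulrC.
  apply: (@wspace_ae_eq _ _ _ gam n0 _ (fun y => \sum_(k < K) (a k / lam k ^+ N) * psi k y)) => //.
  - exact: NwC.
  - by apply: (wspace_sum (fun k => a k / lam k ^+ N)); exact: eigen_rep_wspace.
  apply: filterS2 (iter_green_eigensum a K N) (_ : \forall y \ae mu, forall k, psi k y = phi k y).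
    by move=> y /(_ I) h1 h2 _; rewrite h1; apply: eq_bigr => k _; rewrite h2.
  by apply/ae_foralln => k; apply: filterS (eigen_rep_ae N k) => y /(_ I).
  exact: Ox.
have := NC fL Ox; rewrite NfE (ger0_norm A0) => h.
have [->|Apos] := eqVneq A 0; first by rewrite mulr_ge0 ?sqr_ge0.
have r0 : 0 < rnorm2 mu f.
  by rewrite lt_neqAle rnorm2_ge0 andbT eq_sym; apply: contra_neq Apos; rewrite -fA => ->; rewrite expr0n.
rewrite -exprMn -fA lerXn2r ?nnegrE ?rnorm2_ge0 ?mulr_ge0 ?bdist_pow_ge0 ?(ltW C0)//.
by move: h; rewrite -fA expr2 ler_pM2r.
Qed.

Lemma lam_summable : exists2 B : R, 0 < B &
  forall K, \sum_(k < K) (lam k ^+ (2 * N))^-1 <= B.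
Proof.
have wL : w \in L2 by exact: bdist_pow_L2.
exists (C ^+ 2 * ip w w + 1) => [|K].
  by rewrite ltr_wpDl// mulr_ge0 ?sqr_ge0 ?ip_ge0.
apply: (@le_trans _ _ (C ^+ 2 * ip w w)); last by rewrite lerDl.
have pL k : (fun x => (lam k ^+ N)^-1 * psi k x) \in L2 by apply: Lfun2Z; exact: eigen_rep_L2.
have iK j : mu.-integrable setT (fun x => (\sum_(k < j) (((lam k ^+ N)^-1 * psi k x) * ((lam k ^+ N)^-1 * psi k x))%R)%:E).
  elim: j => [|j ih].
    by under eq_fun do rewrite big_ord0; exact: integrable0.
  under eq_fun do rewrite big_ord_recr/= EFinD.
  by apply: integrableD => //; exact: Lfun2_integrableM.
(* Each representative has norm one, so the sum is the integral of the left side of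
   [eigen_rep_sum_sqr]. *)
have -> : \sum_(k < K) (lam k ^+ (2 * N))^-1 =
    \int[mu]_x (\sum_(k < K) (((lam k ^+ N)^-1 * psi k x) * ((lam k ^+ N)^-1 * psi k x))).
  elim: K => [|K ih].
    rewrite big_ord0 -[LHS](mul0r (fine (mu setT))) -Rintegral_cst//.
    by apply: eq_Rintegral => x _; rewrite big_ord0.
  under [RHS]eq_Rintegral do rewrite big_ord_recr/=.
  rewrite RintegralD//; last exact: Lfun2_integrableM.
  rewrite big_ord_recr/= ih; congr (_ + _).
  rewrite ipZl ?eigen_rep_L2// ipC ipZl ?eigen_rep_L2//.
  rewrite (ae_eq_ipl _ (eigen_L2 HG K) _ (eigen_rep_ae N K)) ?eigen_rep_L2//.
  rewrite ipC (ae_eq_ipl _ (eigen_L2 HG K) _ (eigen_rep_ae N K)) ?eigen_rep_L2 ?eigen_L2//; last exact: (eigen_L2 HG).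
  have := eigen_orthonormal HG K K; rewrite /inner eqxx => ->.
  by rewrite mulr1 mulnC exprM expr2 invfM.
  exact: iK.
rewrite -RintegralZl//; last exact: Lfun2_integrableM.
apply: le_Rintegral => //.
  exact: iK.
  have := integrableZl measurableT (C ^+ 2) (Lfun2_integrableM wL wL).
  by apply: eq_integrable.
move=> x _; apply: le_trans (eigen_rep_sum_sqr K x).
by apply: ler_sum => k _; rewrite expr2 [_^-1 * _]mulrC.
Qed.

Lemma heat_weight_summable (t : R) (q : nat) : 0 < t -> exists2 B : R, 0 < B &
  forall K, \sum_(k < K) expR (- lam k * t) * lam k ^+ q <= B.
Proof.
move=> t0; have [B B0 HB] := lam_summable.
(* The extra [2 * N] powers leave a multiple of the summable lam_k^(-2N). *)
have [D D0 HD] := exprn_expR_le (q + 2 * N) t0.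
exists (D * B) => [|K]; first exact: mulr_gt0.
apply: le_trans (ler_wpM2l (ltW D0) (HB K)).
rewrite mulr_sumr; apply: ler_sum => k _.
have := HD _ (lam_gt0 k); rewrite exprD => h.
rewrite ler_pdivlMr ?exprn_gt0 ?lam_gt0//; apply: le_trans h.
by rewrite le_eqVlt; apply/orP; left; apply/eqP; ring.
Qed.

End regular_index.
End eigenfunctions.

(** * Exponentially damped series with a uniform tail *)

Section exponential_series.
Context {R : realType}.
Variables (lam : nat -> R) (N : nat).
Hypothesis lam0 : forall k, 0 < lam k.
Hypothesis lam_sum : forall t q, 0 < t -> exists2 B : R, 0 < B &
  forall K, \sum_(k < K) expR (- lam k * t) * lam k ^+ q <= B.

Definition exp_sum (t : R) (c p : nat -> R) (K : nat) : R :=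
  \sum_(k < K) expR (- lam k * t) * c k * p k.

Definition exp_lim (t : R) (c p : nat -> R) : R := limn (exp_sum t c p).

Lemma exp_sum_mulr t c p a K :
  exp_sum t c (fun k => a * p k) K = a * exp_sum t c p K.
Proof. by rewrite mulr_sumr; apply: eq_bigr => k _; rewrite mulrCA. Qed.

(** [r] is the tail of the majorant series of exp(-lam_k t) lam_k^(2N), one power [N] for [c] and
    one for [p]. It does not depend on [c] or [p]: this gives uniform convergence when [p] varies
    with a point and operator bounds when [c] varies with the datum. *)
Lemma exp_lim_tail (t : R) : 0 < t -> exists r : nat -> R,
  [/\ forall K, 0 <= r K, r @ \oo --> (0 : R) &
      forall (A W : R) (c p : nat -> R), 0 <= A -> 0 <= W ->
        (forall k, `|c k| <= A * lam k ^+ N) ->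
        (forall k, `|p k| <= W * lam k ^+ N) ->
        forall K, `|exp_lim t c p - exp_sum t c p K| <= A * W * r K].
Proof.
move=> t0; have [B B0 HB] := lam_sum (N + N) t0.
pose S K := \sum_(k < K) expR (- lam k * t) * lam k ^+ (N + N).
have Snd : nondecreasing_seq S.
  apply/nondecreasing_seqP => K.
  by rewrite /S big_ord_recr/= lerDl mulr_ge0 ?expR_ge0// exprn_ge0// ltW.
have Scvg : cvgn S.
  by apply: nondecreasing_is_cvgn => //; exists B => _ [K _ <-]; exact: HB.
exists (fun K => limn S - S K); split.
- by move=> K; rewrite subr_ge0; exact: nondecreasing_cvgn_le.
- rewrite -[X in _ --> X](subrr (limn S)).
  by apply: cvgB => //; exact: cvg_cst.
move=> A W c p A0 W0 cA pW.
pose u k := expR (- lam k * t) * c k * p k.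
have uE k : `|u k| <= A * W * (expR (- lam k * t) * lam k ^+ (N + N)).
  rewrite /u !normrM (ger0_norm (expR_ge0 _)) exprD.
  rewrite [leRHS](_ : _ = expR (- lam k * t) * ((A * lam k ^+ N) * (W * lam k ^+ N))); last by ring.
  by rewrite -mulrA ler_wpM2l ?expR_ge0// ler_pM.
have ucvg : cvgn (exp_sum t c p).
  rewrite (_ : exp_sum t c p = series u); last first.
    by apply/funext => K; rewrite /exp_sum /series/= big_mkord.
  apply: normed_cvg.
  rewrite (_ : [normed series u] = (fun K => \sum_(k < K) `|u k|)); last first.
    by apply/funext => K; rewrite /normed_series_of /series/= big_mkord.
  apply: nondecreasing_is_cvgn.
    by apply/nondecreasing_seqP => K; rewrite big_ord_recr/= lerDl.
  exists (A * W * B) => _ [K _ <-] /=.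
  apply: (@le_trans _ _ (A * W * S K)); last first.
    by apply: ler_wpM2l; [exact: mulr_ge0|exact: HB].
  by rewrite mulr_sumr; apply: ler_sum => k _; exact: uE.
(* Blocks of terms are compared with blocks of the majorant; the tail estimate is the limit in
   [d]. *)
have uS K d : `|exp_sum t c p (K + d)%N - exp_sum t c p K| <= A * W * (S (K + d)%N - S K).
  elim: d => [|d ih]; first by rewrite addn0 !subrr normr0 mulr0.
  rewrite addnS [exp_sum _ _ _ _.+1]big_ord_recr [S _.+1]big_ord_recr/=.
  rewrite -/(S _) -/(u _) addrAC [X in _ * X]addrAC mulrDr.
  by apply: le_trans (ler_normD _ _) _; rewrite lerD//; exact: uE.
move=> K.
have dcvg : `|exp_sum t c p (K + d)%N - exp_sum t c p K| @[d --> \oo] -->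
    `|exp_lim t c p - exp_sum t c p K|.
  apply: cvg_norm; apply: cvgB; last exact: cvg_cst.
  rewrite (_ : (fun d => _) = (fun d => exp_sum t c p (d + K)%N)); last first.
    by apply/funext => d; rewrite addnC.
  by rewrite (cvg_shiftn K (exp_sum t c p) (nbhs (exp_lim t c p))).
rewrite -(cvg_lim (@Rhausdorff R) dcvg); apply: limr_le.
  by apply/cvg_ex; eexists; exact: dcvg.
apply: nearW => d; apply: le_trans (uS K d) _.
rewrite ler_wpM2l ?mulr_ge0// lerD2r.
exact: nondecreasing_cvgn_le.
Qed.

Lemma cvg0_norm_le0 (r : nat -> R) (a b : R) (k : nat) : r @ \oo --> (0 : R) ->
  (forall K, (k <= K)%N -> `|a| <= b * r K) -> a = 0.
Proof.
move=> r0 ab; apply/eqP; rewrite -normr_le0.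
have br : (b * r K) @[K --> \oo] --> (0 : R).
  by rewrite -(mulr0 b); apply: cvgM => //; exact: cvg_cst.
rewrite -(cvg_lim (@Rhausdorff R) br); apply: limr_ge.
  by apply/cvg_ex; eexists; exact: br.
by exists k.
Qed.

End exponential_series.

(** * Bounds and uniform limits on the closure of the domain *)

Section closure_bounds.
Context {R : realType} {n : nat}.
Local Notation E := 'rV[R]_n.
Variables (Om : bounded_domain R n).

Lemma closure_norm_le (v : E -> R) (B : R) : {within closure Om, continuous v} ->
  (forall x, dom Om x -> `|v x| <= B) -> forall x, closure Om x -> `|v x| <= B.
Proof.
move=> /subspace_continuousP cv vB x cx; rewrite leNgt; apply/negP => Bx.
have e0 : 0 < `|v x| - B by rewrite subr_gt0.
have := cv x cx => /(iffLR (@cvgrPdist_lt R R^o _ _ (within_filter _ (nbhs_filter x)) v (v x))) /(_ _ e0).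
rewrite /prop_near1/= /within/= => vx.
have [y [Oy /(_ (subset_closure Oy))]] := cx _ vx.
move=> h.
have := ler_normD (v x - v y) (v y); rewrite subrK => h1.
by have h2 := vB y Oy; lra.
Qed.

Lemma uniform_limit_closure (vs : nat -> E -> R) (V : E -> R) (r : nat -> R) :
  (forall K, {within closure Om, continuous (vs K)}) -> r @ \oo --> (0 : R) ->
  (forall K x, closure Om x -> `|V x - vs K x| <= r K) ->
  {within closure Om, continuous V}.
Proof.
move=> cvs r0 Vr; apply/subspace_continuousP => x cx.
apply: (iffRL (@cvgrPdist_lt R R^o _ _ (within_filter _ (nbhs_filter x)) V (V x))) => e e0.
have e3 : 0 < e / 3 by rewrite divr_gt0.
have [K _ /(_ K (leqnn K))] : \forall K \near \oo, `|0 - r K| < e / 3.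
  by move/cvgrPdist_lt : r0; exact.
rewrite /= sub0r normrN => /(le_lt_trans (ler_norm _)) rK.
have /subspace_continuousP /(_ x cx) := cvs K.
move=> /(iffLR (@cvgrPdist_lt R R^o _ _ (within_filter _ (nbhs_filter x)) (vs K) (vs K x))) /(_ _ e3).
move=> hh; apply: (@filterS2 _ _ (within_filter (closure Om) (nbhs_filter x))
  _ _ _ _ (withinT (closure Om) (nbhs_filter x)) hh) => y cy h3.
have h1 := Vr K x cx; have h2 := Vr K y cy.
rewrite (_ : V x - V y = (V x - vs K x) + (vs K x - vs K y) + - (V y - vs K y)); last by ring.
apply: le_lt_trans (ler_normD _ _) _; rewrite normrN.
have := ler_normD (V x - vs K x) (vs K x - vs K y); lra.
Qed.

End closure_bounds.

(** * Integration against weighted signed measures *)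

Section radon_integrals.
Context {R : realType} {n : nat}.
Local Notation E := 'rV[R]_n.
Variables (Om : bounded_domain R n) (gam : R).
Local Notation w := (bdist_pow Om gam).
Hypothesis n0 : (0 < n)%N.
Hypothesis gam0 : 0 < gam.

Lemma weight_integral_bound (nu : {measure set E -> \bar R}) (f : E -> R) (B : R) :
  0 <= B -> measurable_fun (dom Om) f -> (forall x, dom Om x -> `|f x| <= B * w x) ->
  (\int[nu]_(x in dom Om) `|(f x)%:E| <= B%:E * \int[nu]_(x in dom Om) (w x)%:E)%E.
Proof.
move=> B0 mf fB; have mO := measurable_dom Om.
have mw : measurable_fun (dom Om) (fun x => (w x)%:E).
  by apply/measurable_EFinP; apply: measurable_funTS; exact: measurable_bdist_pow.
rewrite -ge0_integralZl_EFin//; last by move=> x _; rewrite lee_fin bdist_pow_ge0.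
apply: ge0_le_integral => //.
- by apply: measurableT_comp => //; apply/measurable_EFinP.
- by apply: measurable_funeM.
Qed.

Lemma M_norm_split (mu : signed_measure n) : (M_norm Om w mu < +oo)%E ->
  exists a b : R, [/\ 0 <= a, 0 <= b,
    (\int[smpos mu]_(x in dom Om) (w x)%:E = a%:E)%E,
    (\int[smneg mu]_(x in dom Om) (w x)%:E = b%:E)%E &
    M_norm Om w mu = (a + b)%:E].
Proof.
rewrite /M_norm.
have i0 (nu : {measure set E -> \bar R}) : (0 <= \int[nu]_(x in dom Om) (w x)%:E)%E.
  by apply: integral_ge0 => x _; rewrite lee_fin bdist_pow_ge0.
have := i0 (smpos mu); have := i0 (smneg mu).
case: (\int[smpos mu]_(x in dom Om) _)%E => [a||]//;
  case: (\int[smneg mu]_(x in dom Om) _)%E => [b||]//.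
by rewrite !lee_fin => b0 a0 _; exists a, b.
Qed.

Lemma M_space_integrable (mu : signed_measure n) (f : E -> R) (B : R) :
  M_space Om w mu -> 0 <= B -> measurable_fun (dom Om) f ->
  (forall x, dom Om x -> `|f x| <= B * w x) ->
  (smpos mu).-integrable (dom Om) (EFin \o f) /\
  (smneg mu).-integrable (dom Om) (EFin \o f).
Proof.
move=> [_ /M_norm_split[a [b [a0 b0 ea eb _]]]] B0 mf fB.
by split; apply/integrableP; split; [exact/measurable_EFinP| |exact/measurable_EFinP|];
  apply: le_lt_trans (weight_integral_bound _ B0 mf fB) _; rewrite ?ea ?eb -EFinM ltry.
Qed.

Lemma sm_integral_le (mu : signed_measure n) (f : E -> R) (B : R) :
  M_space Om w mu -> 0 <= B -> measurable_fun (dom Om) f ->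
  (forall x, dom Om x -> `|f x| <= B * w x) ->
  `|sm_integral Om mu f| <= B * fine (M_norm Om w mu).
Proof.
move=> muM B0 mf fB; have mO := measurable_dom Om.
have [i1 i2] := M_space_integrable muM B0 mf fB.
have [_ /M_norm_split[a [b [a0 b0 ea eb ->]]]] := muM.
have h (nu : {measure set E -> \bar R}) (c : R) :
    nu.-integrable (dom Om) (EFin \o f) ->
    (\int[nu]_(x in dom Om) (w x)%:E = c%:E)%E ->
    `|\int[nu]_(x in dom Om) f x| <= B * c.
  move=> inu ec; rewrite -lee_fin EFin_normr_Rintegral// EFinM -ec.
  apply: le_trans (weight_integral_bound _ B0 mf fB).
  by apply: le_abse_integral => //; exact/measurable_EFinP.
rewrite /sm_integral; apply: le_trans (ler_normB _ _) _.
by rewrite /= mulrDr lerD// h.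
Qed.

(** [is_difference] equates two sums of three positive measures. The bound of [f] by the weight
    makes it integrable for all six, so both sides can be integrated and the terms rearranged. *)
Lemma sm_integral_difference (mu nu rho : signed_measure n) (f : E -> R) (B : R) :
  M_space Om w mu -> M_space Om w nu -> M_space Om w rho ->
  is_difference mu nu rho -> 0 <= B -> measurable_fun (dom Om) f ->
  (forall x, dom Om x -> `|f x| <= B * w x) ->
  sm_integral Om rho f = sm_integral Om mu f - sm_integral Om nu f.
Proof.
move=> muM nuM rhoM D B0 mf fB; have mO := measurable_dom Om.
have [mu1 mu2] := M_space_integrable muM B0 mf fB.
have [nu1 nu2] := M_space_integrable nuM B0 mf fB.
have [rho1 rho2] := M_space_integrable rhoM B0 mf fB.
have add (m1 m2 m3 : {measure set E -> \bar R}) :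
    m1.-integrable (dom Om) (EFin \o f) -> m2.-integrable (dom Om) (EFin \o f) ->
    m3.-integrable (dom Om) (EFin \o f) ->
    (\int[measure_add (measure_add m1 m2) m3]_(x in dom Om) (f x)%:E =
    (\int[m1]_(x in dom Om) f x + \int[m2]_(x in dom Om) f x +
     \int[m3]_(x in dom Om) f x)%R%:E)%E.
  move=> i1 i2 i3.
  have i12 : (measure_add m1 m2).-integrable (dom Om) (EFin \o f).
    apply/integrableP; split; first by case/integrableP: i1.
    have mf' : measurable_fun (dom Om) (fun x => `|(f x)%:E|%E).
      by apply: measurableT_comp => //; exact/measurable_EFinP.
    rewrite ge0_integral_measure_add//.
    by case/integrableP: i1 => _ ?; case/integrableP: i2 => _ ?; exact: lte_add_pinfty.
  rewrite integral_measure_add// integral_measure_add// !EFinD /Rintegral.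
  by rewrite !fineK//; exact: integrable_fin_num.
have /(congr1 fine) : (\int[measure_add (measure_add (smpos rho) (smneg mu)) (smpos nu)]_(x in dom Om) (f x)%:E =
    \int[measure_add (measure_add (smneg rho) (smpos mu)) (smneg nu)]_(x in dom Om) (f x)%:E)%E.
  apply: eq_measure_integral => A mA _.
  have addE (m1 m2 m3 : {measure set E -> \bar R}) :
      measure_add (measure_add m1 m2) m3 A = (m1 A + m2 A + m3 A)%E.
    by rewrite measure_addE; congr (_ + _)%E; exact: measure_addE.
  exact: etrans (addE _ _ _) (etrans (D A mA) (esym (addE _ _ _))).
rewrite !add// /sm_integral /= => h; lra.
Qed.

Lemma eq_sm_integral (mu : signed_measure n) (f g : E -> R) :
  (forall x, dom Om x -> f x = g x) -> sm_integral Om mu f = sm_integral Om mu g.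
Proof.
by move=> fg; rewrite /sm_integral; congr (_ - _); apply: eq_Rintegral => x; rewrite inE => /fg.
Qed.

Lemma sm_integral_dirac (y : E) (f : E -> R) : dom Om y ->
  measurable_fun (dom Om) f -> sm_integral Om (dirac_sm y) f = f y.
Proof.
move=> Oy mf; have mO := measurable_dom Om.
rewrite /sm_integral /Rintegral /=.
have mf' : measurable_fun (dom Om) (fun x => (f x)%:E) by exact/measurable_EFinP.
by rewrite integral_dirac// integral_measure_zero diracE mem_set// mul1e /= subr0.
Qed.

End radon_integrals.

(** * Heat series with coefficients of polynomial growth in the eigenvalues *)

Section heat_series.
Context {R : realType} {n : nat}.
Local Notation E := 'rV[R]_n.
Variables (Om : bounded_domain R n) (gam : R).
Variables (psi : nat -> E -> R) (lam : nat -> R) (N : nat) (C : R).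
Local Notation mu := (leb Om).
Local Notation L2 := (Lfun mu 2%:E).
Local Notation w := (bdist_pow Om gam).
Local Notation wC := (wspace Om w (C_closure Om)).
Local Notation ip f g := (\int[mu]_x (f x * g x)).
Hypothesis n0 : (0 < n)%N.
Hypothesis gam0 : 0 < gam.
Hypothesis lam0 : forall k, 0 < lam k.
Hypothesis lam_sum : forall t q, 0 < t -> exists2 B : R, 0 < B &
  forall K, \sum_(k < K) expR (- lam k * t) * lam k ^+ q <= B.
Hypothesis C0 : 0 < C.
Hypothesis psi_wC : forall k, wC (psi k).
Hypothesis psi_L2 : forall k, psi k \in L2.
Hypothesis psi_on : forall j k, ip (psi j) (psi k) = (j == k)%:R.
Hypothesis psi_le : forall k x, `|psi k x| <= C * lam k ^+ N * w x.

Definition heat_psum t c K x := exp_sum lam t c (psi ^~ x) K.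
Definition heat_sum t c x := exp_lim lam t c (psi ^~ x).

(** [A] is explicit because estimates linear in it become operator bounds: it will be a multiple of
    the norm of the datum. *)
Definition tempered (A : R) (c : nat -> R) :=
  0 <= A /\ forall k, `|c k| <= A * lam k ^+ N.

Lemma heat_psumE t c K : heat_psum t c K = fun x => \sum_(k < K) (expR (- lam k * t) * c k) * psi k x.
Proof. by []. Qed.

Lemma heat_psum_L2 t c K : heat_psum t c K \in L2.
Proof. exact: (Lfun2_sum (fun k => expR (- lam k * t) * c k)). Qed.

Lemma heat_sum_tail t : 0 < t -> exists r : nat -> R,
  [/\ forall K, 0 <= r K, r @ \oo --> (0 : R),
      forall A c, tempered A c -> forall K x, `|heat_sum t c x - heat_psum t c K x| <= A * r K * w x &
      forall A c, tempered A c -> wC (heat_sum t c)].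
Proof.
move=> t0; have [r [r0 rcv rP]] := exp_lim_tail N lam0 lam_sum t0.
exists (fun K => C * r K); split.
- by move=> K; rewrite mulr_ge0// ltW.
- by rewrite -(mulr0 C); apply: cvgM => //; exact: cvg_cst.
- move=> A c [A0 cA] K x.
  rewrite (_ : A * (C * r K) * w x = A * (C * w x) * r K); last by ring.
  apply: rP => //; first by rewrite mulr_ge0 ?bdist_pow_ge0// ltW.
  by move=> k; rewrite mulrAC; exact: psi_le.
move=> A c [A0 cA].
(* The series is summed a second time for the continuous quotients [v k], uniformly on the closure;
   the sum [V] is the continuous quotient of the heat sum. *)
have /choice[v vP] k : exists v, C_closure Om v /\ forall x, dom Om x -> psi k x = w x * v x.
  by have [v cv pv] := psi_wC k; exists v.
have v_le k x : closure Om x -> `|v k x| <= C * lam k ^+ N.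
  apply: closure_norm_le; first exact: (vP k).1.
  move=> y Oy; have wy := bdist_pow_gt0 n0 gam Oy.
  rewrite -(ler_pM2l wy) -[X in X * `|_|](ger0_norm (ltW wy)) -normrM -(vP k).2//.
  by rewrite mulrC; exact: psi_le.
pose V x := exp_lim lam t c (v ^~ x).
have VP K x : closure Om x -> `|V x - exp_sum lam t c (v ^~ x) K| <= A * C * r K.
  by move=> cx; apply: rP => //; [exact: ltW|move=> k; exact: v_le].
have Arcv : (A * C * r K) @[K --> \oo] --> (0 : R).
  by rewrite -(mulr0 (A * C)); apply: cvgM => //; exact: cvg_cst.
exists V.
  apply: (@uniform_limit_closure _ _ _ (fun K x => exp_sum lam t c (v ^~ x) K) _ _ _ Arcv VP).
  move=> K; rewrite /exp_sum; elim: K => [|K ih].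
    by under eq_fun do rewrite big_ord0; move=> x; exact: cvg_cst.
  under eq_fun do rewrite big_ord_recr/=.
  move=> x; apply: cvgD; first exact: ih.
  by apply: cvgM; [exact: cvg_cst|exact: (vP K).1].
move=> x Ox; have wx := bdist_pow_gt0 n0 gam Ox.
apply/eqP; rewrite -subr_eq0; apply/eqP.
apply: (@cvg0_norm_le0 _ _ _ (2 * (A * C * w x)) 0 rcv) => K _.
have pE : heat_psum t c K x = w x * exp_sum lam t c (v ^~ x) K.
  rewrite -exp_sum_mulr /heat_psum; congr exp_sum; apply/funext => k.
  exact: (vP k).2.
rewrite (_ : heat_sum t c x - w x * V x = (heat_sum t c x - heat_psum t c K x) -
   w x * (V x - exp_sum lam t c (v ^~ x) K)); last by rewrite pE; ring.
apply: le_trans (ler_normB _ _) _.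
rewrite normrM (ger0_norm (ltW wx)).
have h1 : `|heat_sum t c x - heat_psum t c K x| <= A * (C * w x) * r K.
  apply: rP => //; first by rewrite mulr_ge0// ltW.
  by move=> k; rewrite mulrAC; exact: psi_le.
have h2 := ler_wpM2l (ltW wx) (VP K x (subset_closure Ox)).
by apply: le_trans (lerD h1 h2) _; rewrite le_eqVlt; apply/orP; left; apply/eqP; ring.
Qed.

Lemma heat_sum_wspace t A c : 0 < t -> tempered A c -> wC (heat_sum t c).
Proof. by move=> /heat_sum_tail[r [_ _ _]]; apply. Qed.

Lemma heat_sum_le t : 0 < t -> exists2 B : R, 0 < B &
  forall A c, tempered A c -> forall x, `|heat_sum t c x| <= A * B * w x.
Proof.
move=> /heat_sum_tail[r [r0 _ rP _]].
exists (r 0%N + 1) => [|A c cA x]; first by rewrite ltr_wpDl.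
have := rP A c cA 0%N x.
rewrite (_ : heat_psum t c 0 x = 0) ?subr0; last by rewrite /heat_psum /exp_sum big_ord0.
move=> /le_trans; apply; rewrite ler_wpM2r ?bdist_pow_ge0//.
by rewrite ler_wpM2l ?lerDl//; case: cA.
Qed.

Lemma heat_psum_cvg t A c x : 0 < t -> tempered A c ->
  heat_psum t c K x @[K --> \oo] --> heat_sum t c x.
Proof.
move=> /heat_sum_tail[r [r0 rcv rP _]] cA.
apply/cvgrPdist_lt => e e0.
have : (A * w x * r K) @[K --> \oo] --> (0 : R).
  by rewrite -(mulr0 (A * w x)); apply: cvgM => //; exact: cvg_cst.
move=> /cvgrPdist_lt /(_ e e0); apply: filterS => K.
rewrite sub0r normrN => /(le_lt_trans (ler_norm _)); apply: le_lt_trans.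
by rewrite mulrAC; exact: rP.
Qed.

Lemma measurable_heat_sum t A c : 0 < t -> tempered A c -> measurable_fun setT (heat_sum t c).
Proof.
move=> t0 cA; apply: (measurable_fun_cvg (h := heat_psum t c)) => [K|x _].
  exact: Lfun_measurable (heat_psum_L2 t c K).
exact: heat_psum_cvg cA.
Qed.

Lemma heat_sum_L2 t A c : 0 < t -> tempered A c -> heat_sum t c \in L2.
Proof.
move=> t0 cA; have [B B0 HB] := heat_sum_le t0.
apply: (@weighted_Lfun2 _ _ Om gam n0 gam0 _ (A * B)) => [|x _]; last exact: HB.
exact: measurable_heat_sum cA.
Qed.

Lemma heat_sum_rnorm2_tail t : 0 < t -> exists2 r : nat -> R, r @ \oo --> (0 : R) &
  forall A c, tempered A c -> forall K,
    rnorm2 mu (fun x => heat_sum t c x - heat_psum t c K x) <= A * r K.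
Proof.
move=> t0; have [r [r0 rcv rP _]] := heat_sum_tail t0.
exists (fun K => r K * rnorm2 mu w).
  by rewrite -(mul0r (rnorm2 mu w)); apply: cvgM => //; exact: cvg_cst.
move=> A c cA K; rewrite mulrA; apply: rnorm2_le_bound.
- by rewrite mulr_ge0//; case: cA.
- by apply: Lfun2B; [exact: heat_sum_L2 cA|exact: heat_psum_L2].
- exact: bdist_pow_L2.
- by apply: nearW => x; exact: rP.
Qed.

Lemma ip_heat_sum t A c k : 0 < t -> tempered A c ->
  ip (heat_sum t c) (psi k) = expR (- lam k * t) * c k.
Proof.
move=> t0 cA; have [r rcv rP] := heat_sum_rnorm2_tail t0.
apply/eqP; rewrite -subr_eq0; apply/eqP.
(* From [k.+1] on, a partial sum has the exact [k]-th coefficient, and the tail contributes at most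
   its norm. *)
apply: (@cvg0_norm_le0 _ _ _ A k.+1 rcv) => K kK.
have <- : ip (heat_psum t c K) (psi k) = expR (- lam k * t) * c k.
  rewrite heat_psumE (ip_orthonormal_sum psi_L2 psi_on (fun k => expR (- lam k * t) * c k)).
  by rewrite kK mul1r.
have hL := heat_sum_L2 t0 cA; have sL := heat_psum_L2 t c K.
rewrite -ipBl//.
apply: le_trans (ip_orthonormal_le psi_L2 psi_on _ _) _; first exact: Lfun2B.
exact: rP.
Qed.

(** Symmetry of the semigroup in series form: the partial sums of the two sides coincide, one tail
    being small in L^2 and the other at the point [x]. *)
Lemma ip_heat_sum_sym t A A' f x : 0 < t -> f \in L2 -> tempered A (psi ^~ x) ->
  tempered A' (fun k => ip f (psi k)) ->
  ip (heat_sum t (psi ^~ x)) f = heat_sum t (fun k => ip f (psi k)) x.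
Proof.
move=> t0 fL pA fA.
have [r rcv rP] := heat_sum_rnorm2_tail t0; have [r' [r'0 r'cv r'P _]] := heat_sum_tail t0.
apply/eqP; rewrite -subr_eq0; apply/eqP.
have rr : (A * rnorm2 mu f * r K + A' * w x * r' K) @[K --> \oo] --> (0 : R).
  rewrite -(addr0 (0 : R)); apply: cvgD.
    by rewrite -(mulr0 (A * rnorm2 mu f)); apply: cvgM => //; exact: cvg_cst.
  by rewrite -(mulr0 (A' * w x)); apply: cvgM => //; exact: cvg_cst.
apply: (@cvg0_norm_le0 _ _ _ 1 0 rr) => K _; rewrite mul1r.
have hL := heat_sum_L2 t0 pA; have sL := heat_psum_L2 t (psi ^~ x) K.
have sE : ip (heat_psum t (psi ^~ x) K) f = heat_psum t (fun k => ip f (psi k)) K x.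
  rewrite heat_psumE (ip_suml (fun k => expR (- lam k * t) * psi k x))//.
  by apply: eq_bigr => k _; rewrite ipC mulrAC.
rewrite (_ : ip (heat_sum t (psi ^~ x)) f - heat_sum t (fun k => ip f (psi k)) x =
  ip (fun y => heat_sum t (psi ^~ x) y - heat_psum t (psi ^~ x) K y) f -
  (heat_sum t (fun k => ip f (psi k)) x - heat_psum t (fun k => ip f (psi k)) K x)); last first.
  by rewrite ipBl// sE; ring.
apply: le_trans (ler_normB _ _) _; apply: lerD.
  apply: le_trans (ip_CauchySchwarz (Lfun2B hL sL) fL) _.
  by rewrite mulrAC ler_wpM2r ?rnorm2_ge0//; exact: rP.
by rewrite mulrAC; exact: r'P.
Qed.

(** * The semigroup on L^2 *)

Variable phi : nat -> E -> R.
Hypothesis lam_ge : forall k, lam 0%N <= lam k.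
Hypothesis phi_L2 : forall k, phi k \in L2.
Hypothesis phi_on : forall j k, ip (phi j) (phi k) = (j == k)%:R.
Hypothesis psi_phi : forall k, psi k = phi k %[ae mu].
Hypothesis phi_basis : forall f, f \in L2 ->
  Lp_norm Om 2%:E (fun x => f x - \sum_(k < K) inner Om f (phi k) * phi k x)
    @[K --> \oo] --> 0%E.
Hypothesis markov : submarkovian Om phi lam.

Definition coef (f : E -> R) (k : nat) : R := inner Om f (phi k).

Lemma coefE f k : f \in L2 -> coef f k = ip f (psi k).
Proof.
move=> fL; rewrite /coef /inner ipC [RHS]ipC.
by apply: ae_eq_ipl => //; apply: filterS (psi_phi k) => x /[apply] ->.
Qed.

Lemma rnorm2_ae f g : f \in L2 -> g \in L2 -> f = g %[ae mu] -> rnorm2 mu f = rnorm2 mu g.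
Proof.
move=> fL gL fg; congr Num.sqrt.
by rewrite (ae_eq_ipl fL gL fL fg) ipC (ae_eq_ipl fL gL gL fg).
Qed.

(** The coefficients of an L^2 function are bounded by its norm; since [lam 0] is the least
    eigenvalue, [A1] turns this constant bound into a multiple of lam_k^N. *)
Let A1 : R := (lam 0%N ^+ N)^-1.
Let A10 : 0 < A1. Proof. by rewrite invr_gt0 exprn_gt0. Qed.

Lemma coef_tempered f : f \in L2 -> tempered (A1 * rnorm2 mu f) (coef f).
Proof.
move=> fL; split; first by rewrite mulr_ge0 ?rnorm2_ge0// ltW.
move=> k; apply: (@le_trans _ _ (rnorm2 mu f)).
  exact: (ip_orthonormal_le phi_L2 phi_on).
rewrite mulrAC ler_peMl ?rnorm2_ge0// /A1 mulrC ler_pdivlMr ?exprn_gt0// mul1r.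
by rewrite lerXn2r ?nnegrE ?(ltW (lam0 _)).
Qed.

Lemma heat_sum_heat t f : 0 < t -> f \in L2 -> heat Om phi lam t f (heat_sum t (coef f)).
Proof.
move=> t0 fL; have cT := coef_tempered fL.
have hL : heat_sum t (coef f) \in L2 by exact: heat_sum_L2 t0 cT.
split; first exact: hL.
have [r rcv rP] := heat_sum_rnorm2_tail t0.
have sL K : (fun x => \sum_(k < K) (expR (- lam k * t) * coef f k) * phi k x) \in L2.
  exact: (Lfun2_sum (fun k => expR (- lam k * t) * coef f k)).
have NE K : Lp_norm Om 2%:E (fun x => heat_sum t (coef f) x - \sum_(k < K) expR (- lam k * t) * inner Om f (phi k) * phi k x) = (rnorm2 mu (fun x => heat_sum t (coef f) x - heat_psum t (coef f) K x))%:E.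
  rewrite /Lp_norm Lnorm2E; last exact: Lfun2B.
  congr (_%:E); apply: rnorm2_ae.
  - exact: Lfun2B.
  - by apply: Lfun2B => //; exact: heat_psum_L2.
  have : \forall x \ae mu, forall k, psi k x = phi k x.
    by apply/ae_foralln => k; apply: filterS (psi_phi k) => y /(_ I).
  apply: filterS => x h _; congr (_ - _).
  by apply: eq_bigr => k _; rewrite h.
under eq_cvg do rewrite NE.
apply: cvg_EFin; first exact: nearW.
apply: (@squeeze_cvgr _ _ _ _ (fun=> 0) (fun K => A1 * rnorm2 mu f * r K)).
- by apply: nearW => K /=; rewrite rnorm2_ge0 rP.
- exact: cvg_cst.
- by rewrite -[X in _ --> X](mulr0 (A1 * rnorm2 mu f)); apply: cvgM => //; exact: cvg_cst.
Qed.

(** Both are L^2 limits of the same partial sums. Hence the relation [heat] is single-valued up to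
    null sets, and estimates for [heat_sum] apply to every image. *)
Lemma heat_unique t f u u' : heat Om phi lam t f u -> heat Om phi lam t f u' ->
  u = u' %[ae mu].
Proof.
move=> [uL ucv] [u'L u'cv].
have sL K : (fun x => \sum_(k < K) (expR (- lam k * t) * coef f k) * phi k x) \in L2.
  exact: (Lfun2_sum (fun k => expR (- lam k * t) * coef f k)).
have NE v K : v \in L2 -> Lp_norm Om 2%:E (fun x => v x - \sum_(k < K) expR (- lam k * t) * inner Om f (phi k) * phi k x) = (rnorm2 mu (fun x => v x - \sum_(k < K) (expR (- lam k * t) * coef f k) * phi k x))%:E.
  by move=> vL; rewrite /Lp_norm Lnorm2E//; exact: Lfun2B.
have cvr v : v \in L2 -> Lp_norm Om 2%:E (fun x => v x - \sum_(k < K) expR (- lam k * t) * inner Om f (phi k) * phi k x) @[K --> \oo] --> 0%E ->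
    rnorm2 mu (fun x => v x - \sum_(k < K) (expR (- lam k * t) * coef f k) * phi k x) @[K --> \oo] --> (0 : R).
  move=> vL /fine_cvg; apply: cvg_trans; apply: near_eq_cvg; apply: nearW => K /=.
  by rewrite NE.
have uu'L := Lfun2B uL u'L.
have uu' : rnorm2 mu (fun x => u x - u' x) = 0.
  pose a K := rnorm2 mu (fun x => u x - \sum_(k < K) (expR (- lam k * t) * coef f k) * phi k x).
  pose b K := rnorm2 mu (fun x => u' x - \sum_(k < K) (expR (- lam k * t) * coef f k) * phi k x).
  have ra : a @ \oo --> (0 : R) by exact: cvr.
  have rb : b @ \oo --> (0 : R) by exact: cvr.
  have rr : (a K + b K) @[K --> \oo] --> (0 + 0 : R) by apply: cvgD.
  rewrite addr0 in rr.
  apply: (@cvg0_norm_le0 _ _ _ 1 0 rr) => K _; rewrite mul1r ger0_norm ?rnorm2_ge0//.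
  rewrite /a /b; have s1 := Lfun2B uL (sL K); have s2 := Lfun2B u'L (sL K).
  rewrite [X in rnorm2 _ X](_ : _ = fun x =>
    (u x - \sum_(k < K) (expR (- lam k * t) * coef f k) * phi k x) +
    (-1) * (u' x - \sum_(k < K) (expR (- lam k * t) * coef f k) * phi k x)); last first.
    by apply/funext => x; ring.
  apply: le_trans (rnorm2D s1 (Lfun2Z (-1) s2)) _.
  rewrite lerD2l /rnorm2 ipZl// ?Lfun2Z// ipC ipZl//.
  by rewrite mulrA mulrNN !mul1r.
apply: filterS (rnorm2_eq0 uu'L uu') => x /[apply] /=.
by move/eqP; rewrite subr_eq0 => /eqP.
Qed.

Lemma heat_sumB t A A' c c' x : 0 < t -> tempered A c -> tempered A' c' ->
  heat_sum t (fun k => c k - c' k) x = heat_sum t c x - heat_sum t c' x.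
Proof.
move=> t0 cT c'T.
apply/(cvg_lim (@Rhausdorff R)).
have h1 := heat_psum_cvg (x := x) t0 cT.
have h2 := heat_psum_cvg (x := x) t0 c'T.
rewrite (_ : exp_sum _ _ _ _ = fun K => heat_psum t c K x - heat_psum t c' K x).
  exact: cvgB.
apply/funext => K; rewrite /heat_psum /exp_sum -sumrB; apply: eq_bigr => k _.
by rewrite mulrBr mulrBl.
Qed.

Lemma coefB f g : f \in L2 -> g \in L2 ->
  coef (fun x => f x - g x) = fun k => coef f k - coef g k.
Proof. by move=> fL gL; apply/funext => k; exact: ipBl. Qed.

Lemma heat_sum_coef_le t : 0 < t -> exists2 B : R, 0 < B &
  forall f, f \in L2 -> forall x, `|heat_sum t (coef f) x| <= B * rnorm2 mu f * w x.
Proof.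
move=> t0; have [B B0 HB] := heat_sum_le t0.
exists (A1 * B) => [|f fL x]; first by rewrite mulr_gt0.
by rewrite [A1 * B * _]mulrAC; exact: HB _ _ (coef_tempered fL) x.
Qed.

Lemma heat_sum_coef_wspace t f : 0 < t -> f \in L2 -> wC (heat_sum t (coef f)).
Proof. by move=> t0 fL; apply: heat_sum_wspace t0 (coef_tempered fL). Qed.

Lemma heat_ultracontractive : ultracontractive Om phi lam.
Proof.
move=> t t0; have [B B0 HB] := heat_sum_coef_le t0.
have [D D0 wD] := bdist_pow_bounded Om n0 gam0.
exists (B * D) => [|f fL]; first exact: mulr_gt0.
have fB : \forall x \ae mu, `|heat_sum t (coef f) x| <= B * D * rnorm2 mu f.
  apply: nearW => x; apply: le_trans (HB f fL x) _.
  by rewrite mulrAC ler_wpM2r ?rnorm2_ge0// ler_wpM2l ?(ltW B0).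
have B0' : 0 <= B * D * rnorm2 mu f by rewrite !mulr_ge0 ?rnorm2_ge0// ltW.
exists (heat_sum t (coef f)); split.
- exact: heat_sum_heat.
- by apply: Lfun_infty fB => //; apply: measurable_heat_sum t0 (coef_tempered fL).
- by rewrite {2}/Lp_norm Lnorm2E// -EFinM; exact: Lnorm_infty_le.
Qed.

Lemma heat_L2_continuous t : 0 < t -> continuous_op
  (Lp Om 2%:E) (Lp_dist Om 2%:E) wC (wdist w (C_norm Om)) (heat Om phi lam t).
Proof.
move=> t0 f fL; split.
  by exists (heat_sum t (coef f)); [exact: heat_sum_coef_wspace|exact: heat_sum_heat].
move=> u uC fu e e0; have [B B0 HB] := heat_sum_coef_le t0.
(* Any image lying in the weighted space equals the heat sum at every point of the domain, by
   uniqueness and continuity. *)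
have uE (g v : E -> R) : g \in L2 -> wC v -> heat Om phi lam t g v ->
    forall x, dom Om x -> v x = heat_sum t (coef g) x.
  move=> gL vC gv; apply: (wspace_ae_eq n0 vC (heat_sum_coef_wspace t0 gL)).
  by apply: heat_unique gv _; exact: heat_sum_heat.
(* Half of [e], since strictness is lost in the supremum that defines [C_norm]. *)
exists (e / 2 / B) => [|g v gL vC gv]; first by rewrite !divr_gt0.
rewrite /Lp_dist /Lp_norm Lnorm2E ?lte_fin; last exact: Lfun2B.
rewrite ltr_pdivlMr// => fge.
apply: (@le_lt_trans _ _ (e / 2)%:E); last by rewrite lte_fin; lra.
apply: ge_ereal_sup => _ [x Ox <-]; rewrite lee_fin.
have wx := bdist_pow_gt0 n0 gam Ox.
rewrite (uE f u)// (uE g v)// normrM normfV (ger0_norm (ltW wx)) ler_pdivrMr//.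
rewrite -(heat_sumB x t0 (coef_tempered fL) (coef_tempered gL)) -coefB//.
apply: le_trans (HB _ (Lfun2B fL gL) x) _.
by rewrite ler_wpM2r ?(ltW wx)// mulrC ltW.
Qed.

(** * The semigroup on weighted measures *)

Lemma measurable_psi k : measurable_fun (dom Om) (psi k).
Proof. by apply: measurable_funTS; exact: Lfun_measurable (psi_L2 k). Qed.

Definition mcoef (m : signed_measure n) (k : nat) : R := sm_integral Om m (psi k).

Lemma psi_bound k : 0 <= C * lam k ^+ N.
Proof. by rewrite mulr_ge0 ?exprn_ge0// ltW. Qed.

Lemma mcoef_tempered m : M_space Om w m -> tempered (C * fine (M_norm Om w m)) (mcoef m).
Proof.
move=> mM; have [_ /M_norm_split[a [b [a0 b0 _ _ mE]]]] := mM.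
split; first by rewrite mE mulr_ge0 ?addr_ge0// ltW.
move=> k; rewrite mulrAC; apply: (sm_integral_le n0 mM (psi_bound k) (measurable_psi k)).
by move=> x _; exact: psi_le.
Qed.

(** The representative in [heat_measure] is existentially quantified for each [k], but continuity
    forces it to agree with [psi k] on the domain, so the coefficients are determined. *)
Lemma heat_measure_coef t m u : heat_measure Om gam phi lam t m u ->
  forall k, inner Om u (phi k) = expR (- lam k * t) * mcoef m k.
Proof.
move=> [_ h] k; have [q [qC qphi ->]] := h k; congr (_ * _).
apply: eq_sm_integral; apply: (wspace_ae_eq n0 qC (psi_wC k)).
by apply: filterS2 qphi (psi_phi k) => x /(_ I) -> /(_ I) ->.
Qed.

Lemma heat_sum_heat_measure t A m : 0 < t -> tempered A (mcoef m) ->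
  heat_measure Om gam phi lam t m (heat_sum t (mcoef m)).
Proof.
move=> t0 mT; have hL : heat_sum t (mcoef m) \in L2 by exact: heat_sum_L2 t0 mT.
split=> // k; exists (psi k); split => //.
by rewrite -/(coef _ k) coefE//; apply: ip_heat_sum => //; exact: mT.
Qed.

Lemma heat_M_continuous t : 0 < t -> continuous_op
  (M_space Om w) (M_dist Om w) (Lp Om 2%:E) (Lp_dist Om 2%:E)
  (heat_measure Om gam phi lam t).
Proof.
move=> t0 m mM; split.
  exists (heat_sum t (mcoef m)); last exact: heat_sum_heat_measure t0 (mcoef_tempered mM).
  exact: heat_sum_L2 t0 (mcoef_tempered mM).
move=> u uL mu_ e e0; have [B B0 HB] := lam_sum (N + N) t0.
(* The squared coefficients of the difference sum to at most (C (a + b))^2 B; replacing [B] by the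
   larger (B + 1)^2 avoids a square root. *)
pose D := C * (B + 1); have D0 : 0 < D by rewrite mulr_gt0// addr_gt0.
exists (e / D) => [|m' u' m'M u'L m'u']; first by rewrite divr_gt0.
(* The distance is an infimum, so some measure [rho] representing the difference has norm below
   [e / D]. *)
move=> /ereal_inf_lt[_ [rho [rhoM diff] <-]].
have [_ /M_norm_split[a [b [a0 b0 _ _ rhoE]]]] := rhoM.
rewrite rhoE lte_fin => abe.
have uu'L : (fun x => u x - u' x) \in L2 by exact: Lfun2B.
rewrite /Lp_dist /Lp_norm Lnorm2E// lte_fin.
have ab0 : 0 <= a + b by exact: addr_ge0.
apply: (@le_lt_trans _ _ (D * (a + b))); last by rewrite mulrC -ltr_pdivlMr.
apply: (rnorm2_le_coef phi_L2 phi_on uu'L).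
- by rewrite mulr_ge0// ltW.
- exact: (phi_basis uu'L).
have cE k : ip (fun x => u x - u' x) (phi k) = expR (- lam k * t) * mcoef rho k.
  rewrite ipBl// -/(inner Om u (phi k)) -/(inner Om u' (phi k)).
  rewrite (heat_measure_coef mu_) (heat_measure_coef m'u') -mulrBr; congr (_ * _).
  rewrite /mcoef (sm_integral_difference n0 mM m'M rhoM diff (psi_bound k))//.
  exact: measurable_psi.
have [_ rhoT] := mcoef_tempered rhoM.
move=> K; apply: (@le_trans _ _ ((C * (a + b)) ^+ 2 * B)); last first.
  rewrite /D [leRHS](_ : _ = (C * (a + b)) ^+ 2 * (B + 1) ^+ 2); last by ring.
  rewrite ler_wpM2l ?sqr_ge0// sqrrD mulr1 expr1n.
  have := sqr_ge0 B; lra.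
apply: le_trans (ler_wpM2l (sqr_ge0 _) (HB K)); rewrite mulr_sumr.
apply: ler_sum => k _; rewrite cE exprMn.
have ek : expR (- lam k * t) ^+ 2 <= expR (- lam k * t).
  rewrite expr2 ler_piMr ?expR_ge0// -expR0 ler_expR mulNr oppr_le0.
  by rewrite mulr_ge0 ?ltW.
have mk : mcoef rho k ^+ 2 <= (C * (a + b)) ^+ 2 * lam k ^+ (N + N).
  have := rhoT k; rewrite rhoE /= => h.
  rewrite addnn -muln2 exprM -exprMn -real_normK ?num_real// lerXn2r ?nnegrE//.
  exact: le_trans (normr_ge0 _) h.
by rewrite [leRHS]mulrCA; apply: ler_pM => //; exact: sqr_ge0.
Qed.

(** * The heat kernel: sign, mass and normal derivative *)

(** The spectral series of exp(-lam_k t) psi_k(x) psi_k(y), since psi_k(y) is the [k]-th coefficient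
    of the Dirac mass at [y]. *)
Definition heat_ker (t : R) (x y : E) : R := heat_sum t (psi ^~ y) x.

(** The factor [w y] in the constant becomes the weight in [y] of the kernel bound; the weight in
    [x] comes from the heat sum. *)
Lemma psi_tempered y : tempered (C * w y) (psi ^~ y).
Proof.
split; first by rewrite mulr_ge0 ?bdist_pow_ge0// ltW.
by move=> k; rewrite mulrAC.
Qed.

Lemma heat_ker_wspace t y : 0 < t -> wC (heat_ker t ^~ y).
Proof. by move=> t0; apply: heat_sum_wspace t0 (psi_tempered y). Qed.

Lemma heat_ker_L2 t y : 0 < t -> heat_ker t ^~ y \in L2.
Proof. by move=> t0; apply: heat_sum_L2 t0 (psi_tempered y). Qed.

Lemma heat_kerP : heat_kernel Om gam phi lam heat_ker.
Proof.
move=> t y t0 Oy.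
have mE : mcoef (dirac_sm y) = psi ^~ y.
  by apply/funext => k; apply: sm_integral_dirac => //; exact: measurable_psi.
split; last exact: (wspace_continuous n0 (heat_ker_wspace y t0)).
rewrite /heat_ker -mE; apply: (@heat_sum_heat_measure _ (C * w y)) => //.
by rewrite mE; exact: psi_tempered.
Qed.

Lemma heat_sum_markov t f : 0 < t -> f \in L2 -> (\forall x \ae mu, 0 <= f x <= 1) ->
  forall x, dom Om x -> 0 <= heat_sum t (coef f) x <= 1.
Proof.
move=> t0 fL f01 x Ox.
have h := markov (ltW t0) fL f01 (heat_sum_heat t0 fL).
have hC := heat_sum_coef_wspace t0 fL.
have c1 := wspace_continuous n0 hC.
have c2 := wspace_continuous n0 (wspaceZ (-1) hC).
apply/andP; split.
  by apply: (ae_le_continuous_dom c1) => //; apply: filterS h => y /andP[].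
rewrite -lerN2 -[leRHS]mulN1r.
apply: (ae_le_continuous_dom c2) => //.
by apply: filterS h => y /andP[_ h1]; rewrite mulN1r lerN2.
Qed.

Lemma ip_heat_ker t f y : 0 < t -> f \in L2 ->
  ip (heat_ker t ^~ y) f = heat_sum t (coef f) y.
Proof.
move=> t0 fL.
have cE : coef f = fun k => ip f (psi k) by apply/funext => k; exact: coefE.
have cT := coef_tempered fL; rewrite cE in cT *.
exact: (ip_heat_sum_sym t0 fL (psi_tempered y) cT).
Qed.

(* The negative part of [S(t, ., y)], scaled into [0, 1], is an admissible datum
   whose image at [y] is minus the square of its own norm. *)
Lemma heat_ker_ge0 t x y : 0 < t -> dom Om x -> dom Om y -> 0 <= heat_ker t x y.
Proof.
move=> t0 Ox Oy.
set h := heat_ker t ^~ y; have hL : h \in L2 by exact: heat_ker_L2.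
have mh := Lfun_measurable hL.
pose m z := Num.max (- h z) 0.
have mm : measurable_fun setT m.
  by apply: measurable_maxr => //; exact: measurableT_comp.
have m0 z : 0 <= m z by rewrite le_max lexx orbT.
have [B B0 HB] := heat_sum_le t0.
have [D D0 wD] := bdist_pow_bounded Om n0 gam0.
pose L := C * w y * B * D + 1.
have L0 : 0 < L by rewrite ltr_wpDl// !mulr_ge0 ?bdist_pow_ge0// ltW.
have mL z : m z <= L.
  have hz : `|h z| <= C * w y * B * D.
    apply: le_trans (HB _ _ (psi_tempered y) z) _.
    by rewrite ler_wpM2l// !mulr_ge0 ?bdist_pow_ge0// ltW.
  rewrite ge_max (ltW L0) andbT; have := ler_norm (- h z); rewrite normrN /L; lra.
have mL2 : m \in L2.
  by apply: (@ae_bounded_Lfun2 _ _ _ _ L) => //; apply: nearW => z; rewrite ger0_norm.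
have fL := Lfun2Z L^-1 mL2.
have f01 : \forall z \ae mu, 0 <= L^-1 * m z <= 1.
  apply: nearW => z; rewrite mulr_ge0 ?invr_ge0 ?(ltW L0)//=.
  by rewrite mulrC ler_pdivrMr// mul1r.
have /andP[+ _] := heat_sum_markov t0 fL f01 Oy.
rewrite -ip_heat_ker// -/h ipC ipZl// pmulr_rge0 ?invr_gt0// ipC.
have -> : ip h m = - ip m m.
  rewrite -mulN1r -ipZl//; apply: eq_Rintegral => z _; rewrite /m.
  have [hz|hz] := leP (- h z) 0; first by rewrite !mulr0.
  by ring.
rewrite oppr_ge0 => mle.
have m20 : rnorm2 mu m = 0.
  apply/eqP; rewrite -sqrf_eq0 rnorm2_sqr eq_le mle/=; exact: ip_ge0.
apply: (ae_le_continuous_dom (wspace_continuous n0 (heat_ker_wspace y t0))) => //.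
apply: filterS (rnorm2_eq0 mL2 m20) => z /(_ I) /= mz.
by rewrite -oppr_le0 -mz /m le_max lexx.
Qed.

(** The constant [1] is an admissible datum, and by symmetry its image at [y] is the mass of the
    kernel. *)
Lemma heat_ker_mass t y : 0 < t -> dom Om y ->
  (\int[@lebesgue_rV R n]_(x in dom Om) (heat_ker t x y)%:E <= 1)%E.
Proof.
move=> t0 Oy; have hL := heat_ker_L2 y t0.
have mh := Lfun_measurable hL.
rewrite -integral_leb_dom//; last exact/measurable_EFinP.
have L1 : (cst 1 : E -> R) \in L2.
  by apply: (@ae_bounded_Lfun2 _ _ _ _ 1) => //; apply: nearW => x; rewrite normr1.
have f01 : \forall z \ae mu, 0 <= (cst 1 : E -> R) z <= 1.
  by apply: nearW => z /=; rewrite ler01 lexx.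
have /andP[_] := heat_sum_markov t0 L1 f01 Oy.
rewrite -ip_heat_ker// -lee_fin /Rintegral fineK.
  by under eq_integral do rewrite mulr1.
exact: (integrable_fin_num measurableT (Lfun2_integrableM hL L1)).
Qed.

Lemma heat_ker_bound t : 0 < t -> exists2 B : R, 0 < B &
  forall x y, `|heat_ker t x y| <= B * w x * w y.
Proof.
move=> t0; have [B B0 HB] := heat_sum_le t0.
exists (C * B) => [|x y]; first exact: mulr_gt0.
apply: le_trans (HB _ _ (psi_tempered y) x) _.
by move: (w x) (w y) => p q; rewrite [C * q * B]mulrAC [C * B * q * p]mulrAC.
Qed.

Lemma normal_quotient_cvg (f v : E -> R) (zeta : E) : closure Om zeta ->
  {within closure Om, continuous v} -> (forall x, dom Om x -> f x = w x * v x) ->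
  normal_quotient Om gam f zeta --> v zeta.
Proof.
move=> cz /subspace_continuousP cv fv.
have h := cv zeta cz.
have : v x @[x --> within (dom Om) (nbhs zeta)] --> v zeta.
  by apply: cvg_trans h; apply: cvg_app; apply: within_subset; exact: subset_closure.
apply: cvg_trans; apply: near_eq_cvg.
have := withinT (dom Om) (nbhs_filter zeta); apply: filterS => x Ox.
by rewrite fv// mulrC mulKf// gt_eqF// bdist_pow_gt0.
Qed.

(** The continuous quotient of the kernel by the weight serves as [v]: its boundary values are the
    limits, and bounds on the domain extend to them by density. *)
Lemma heat_ker_normal t y : 0 < t -> dom Om y -> exists v : E -> R,
  [/\ forall zeta, boundary Om zeta ->
        normal_quotient Om gam (heat_ker t ^~ y) zeta --> v zeta &
      forall B : R, 0 <= B ->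
        (forall x, dom Om x -> heat_ker t x y <= B * w x) ->
      forall zeta, boundary Om zeta -> 0 <= v zeta <= B].
Proof.
move=> t0 Oy; have [v cv hv] := heat_ker_wspace y t0.
exists v; split=> [zeta [cz _]|B B0 hB zeta [cz _]].
  exact: normal_quotient_cvg.
(* Membership in the interval from [0] to [B] is recast as a bound on an absolute value, so that one
   use of [closure_norm_le] gives both inequalities. *)
have v2 x : closure Om x -> `|v x - B / 2| <= B / 2.
  apply: (@closure_norm_le _ _ _ (fun x => v x - B / 2)).
    by move=> z; apply: cvgB; [exact: cv|exact: cvg_cst].
  move=> z Oz; have wz := bdist_pow_gt0 n0 gam Oz.
  have h0 := heat_ker_ge0 t0 Oz Oy; have h1 := hB z Oz.
  rewrite hv// in h0 h1; rewrite pmulr_rge0// in h0.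
  rewrite mulrC ler_pM2r// in h1.
  by rewrite ler_norml; apply/andP; split; lra.
by have := v2 zeta cz; rewrite ler_norml => /andP[h1 h2]; apply/andP; split; lra.
Qed.

(** [normal_derivative] is defined through [lim], which convergence identifies only along a proper
    filter. *)
Lemma closure_proper zeta : closure Om zeta -> ProperFilter (within (dom Om) (nbhs zeta)).
Proof.
move=> cz; split; last exact: within_filter.
by move=> /cz[x [Ox /(_ Ox)]].
Qed.

Lemma heat_kernel_estimates : exists S : R -> E -> E -> R,
  [/\ heat_kernel Om gam phi lam S,
      forall t zeta y, 0 < t -> boundary Om zeta -> dom Om y ->
        cvg (normal_quotient Om gam (fun x => S t x y) zeta) &
      forall t : R, 0 < t -> exists2 C : R, 0 < C &
        [/\ forall x y, dom Om x -> dom Om y ->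
              0 <= S t x y <= C * bdist_pow Om gam x * bdist_pow Om gam y,
            forall y, dom Om y ->
              (\int[@lebesgue_rV R n]_(x in Om) (S t x y)%:E <= 1)%E &
            forall zeta y, boundary Om zeta -> dom Om y ->
              0 <= normal_derivative Om gam (fun x => S t x y) zeta
                <= C * bdist_pow Om gam y]].
Proof.
exists heat_ker; split; first exact: heat_kerP.
  move=> t zeta y t0 bz Oy; have [v [h _]] := heat_ker_normal t0 Oy.
  by apply/cvg_ex; exists (v zeta); exact: h.
move=> t t0; have [B B0 HB] := heat_ker_bound t0; exists B => //; split.
- move=> x y Ox Oy; rewrite heat_ker_ge0//=.
  by apply: le_trans (ler_norm _) _; exact: HB.
- by move=> y Oy; exact: heat_ker_mass.
move=> zeta y bz Oy; have [v [h hb]] := heat_ker_normal t0 Oy.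
have pf := closure_proper bz.1.
rewrite /normal_derivative (cvg_lim (@Rhausdorff R) (h zeta bz)).
apply: (hb (B * w y)) => //; first by rewrite mulr_ge0 ?bdist_pow_ge0// ltW.
move=> x Ox; apply: le_trans (ler_norm _) _; apply: le_trans (HB x y) _.
by move: (w x) (w y) => p q; rewrite mulrAC.
Qed.

End heat_series.

Theorem theorem6p1 (R : realType) (n : nat) (s gam : R)
    (Om : bounded_domain R n) (G : 'rV[R]_n -> 'rV[R]_n -> \bar R)
    (phi : nat -> 'rV[R]_n -> R) (lam : nat -> R) :
  0 < s < 1 -> 0 < gam <= 1 -> 2 * s < n%:R ->
  green_eigensystem Om G phi lam ->
  green_estimate Om G s gam ->
  continuous_op
    (wspace Om (bdist_pow Om gam) (Lp Om +oo%E))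
    (wdist (bdist_pow Om gam) (Lp_norm Om +oo%E))
    (wspace Om (bdist_pow Om gam) (C_closure Om))
    (wdist (bdist_pow Om gam) (C_norm Om))
    (green_graph Om G) ->
  submarkovian Om phi lam ->
  [/\ ultracontractive Om phi lam,
      forall t : R, 0 < t -> continuous_op
        (Lp Om 2%:E) (Lp_dist Om 2%:E)
        (wspace Om (bdist_pow Om gam) (C_closure Om))
        (wdist (bdist_pow Om gam) (C_norm Om))
        (heat Om phi lam t),
      forall t : R, 0 < t -> continuous_op
        (M_space Om (bdist_pow Om gam)) (M_dist Om (bdist_pow Om gam))
        (Lp Om 2%:E) (Lp_dist Om 2%:E)
        (heat_measure Om gam phi lam t) &
      exists S : R -> 'rV[R]_n -> 'rV[R]_n -> R,
        [/\ heat_kernel Om gam phi lam S,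
            forall t zeta y, 0 < t -> boundary Om zeta -> dom Om y ->
              cvg (normal_quotient Om gam (fun x => S t x y) zeta) &
            forall t : R, 0 < t -> exists2 C : R, 0 < C &
              [/\ forall x y, dom Om x -> dom Om y ->
                    0 <= S t x y <=
                      C * bdist_pow Om gam x * bdist_pow Om gam y,
                  forall y, dom Om y ->
                    (\int[@lebesgue_rV R n]_(x in Om) (S t x y)%:E <= 1)%E &
                  forall zeta y, boundary Om zeta -> dom Om y ->
                    0 <= normal_derivative Om gam (fun x => S t x y) zeta
                      <= C * bdist_pow Om gam y]]].
Proof.
move=> s01 gam01 s2n HG HE HC markov.
have n0 := dimension_gt0 s01 s2n.
have gam0 : 0 < gam by case/andP: gam01.
have [N [N0 NwC [C C0 NC]]] := iter_green_regular s01 gam01 s2n HG HE HC.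
have lam0 := lam_gt0 HG; have lam_min := lam_ge HG.
have lam_sum t q := @heat_weight_summable _ _ _ _ _ _ _ _ s01 gam01 s2n HG HE _ _ N0 NwC C0 NC t q.
have psi_L2 := eigen_rep_L2 HG N.
have phi_L2 := eigen_L2 HG.
have psi_phi := eigen_rep_ae s01 s2n HG HE N.
have psi_wC := eigen_rep_wspace HG NwC.
have psi_le := eigen_rep_le HG N0 C0 NC.
have phi_on := eigen_orthonormal HG.
pose psi := eigen_rep Om G phi lam N.
(* Orthonormality passes from [phi] to its regular representatives, one argument of the inner
   product at a time. *)
have psi_on j k : \int[leb Om]_x (psi j x * psi k x) = (j == k)%:R.
  rewrite (ae_eq_ipl (psi_L2 j) (phi_L2 j) (psi_L2 k) (psi_phi j)) ipC.
  by rewrite (ae_eq_ipl (psi_L2 k) (phi_L2 k) (phi_L2 j) (psi_phi k)) ipC; exact: phi_on.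
split.
- exact: (heat_ultracontractive n0 gam0 lam0 lam_sum C0 psi_wC psi_L2 psi_le
    lam_min phi_L2 phi_on psi_phi).
- move=> t; exact: (heat_L2_continuous n0 gam0 lam0 lam_sum C0 psi_wC psi_L2
    psi_le lam_min phi_L2 phi_on psi_phi).
- move=> t; exact: (heat_M_continuous n0 gam0 lam0 lam_sum C0 psi_wC psi_L2
    psi_on psi_le phi_L2 phi_on psi_phi (eigen_basis HG)).
exact: (heat_kernel_estimates n0 gam0 lam0 lam_sum C0 psi_wC psi_L2 psi_on psi_le
  lam_min phi_L2 phi_on psi_phi markov).
Qed.
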